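(* Let $E,F\in\mathrm{Mod}(Q)$ be exceptional (and right and left Hom-finite). If $E\perp F$, then $E'=\tilde{\varpi}_F(E)$ is exceptional, and $\{F,E'\}$ generates the same abelian subcategory as $\{E,F\}$, i.e. $\langle F,E'\rangle=\langle E,F\rangle$. Moreover, we have (up to natural isomorphism of functors) $$\tilde{\pi}_{F}\tilde{\pi}_E=\tilde{\pi}_{E'}\tilde{\pi}_{F},\qquad \iota_E \iota_{F} = \iota_{F}\iota_{E'},\qquad \tilde{\pi}_{F}\iota_{E}=\iota_{E'}\tilde{\pi}_{F}.$$
   Context: $k$ is a field and $Q$ is a finite quiver, possibly with oriented cycles. $\mathrm{Mod}(Q)$ is the category of finitely generated left $kQ$-modules. Write $\mathrm{Ext}_Q=\mathrm{Ext}^1_{kQ}$ and $\mathrm{Hom}^\bullet_Q(M,N)=\mathrm{Hom}_Q(M,N)\oplus\mathrm{Ext}_Q(M,N)$. Write $M\perp N$ ($M$ is left orthogonal to $N$) if $\mathrm{Hom}^\bullet_Q(M,N)=0$. For a collection $\mathcal{C}$ of modules, $\mathcal{C}^\perp=\{N\mid M\perp N\ \forall M\in\mathcal{C}\}$ (a full abelian subcategory), and $\langle\mathcal{C}\rangle$ is the abelian subcategory generated by $\mathcal{C}$ (the smallest full subcategory containing $\mathcal{C}$ closed under kernels, cokernels and extensions). A module $E$ is exceptional if $\mathrm{Hom}_Q^\bullet(E,E)$ is $1$-dimensional, generated by the identity. It is right and left Hom-finite if $\mathrm{Hom}_Q^\bullet(E,X)$ and $\mathrm{Hom}_Q^\bullet(X,E)$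 are finite-dimensional for all $X\in\mathrm{Mod}(Q)$; exceptional modules are assumed to be such throughout. For exceptional $E$, $\iota_E:E^\perp\to\mathrm{Mod}(Q)$ is the inclusion and $\tilde\pi_E:\mathrm{Mod}(Q)\to E^\perp$ is its left adjoint. Concretely, $\tilde\pi_E(M)$ is obtained by taking the universal extension $0\to M\to M'\to E^e\to0$ (for which the connecting map $\mathrm{Hom}_Q(E,E^e)\to\mathrm{Ext}_Q(E,M)$ is an isomorphism) and then the cokernel of the universal homomorphism $E^h\to M'$; the order of the two steps may be exchanged. If $\tilde\pi_E(M)=0$, then the universal homomorphism $E^h\to M$ is surjective and $\tilde\varpi_E(M)$ is defined to be its kernel; otherwise $\tilde\varpi_E(M)=\tilde\pi_E(M)$. In the relations, the functors are those between the categories in the square with corners $\mathrm{Mod}(Q)$, $E^\perp$, $F^\perp$ and $\{E,F\}^\perp$. That is, $\tilde\pi_F$ and $\iota_F$ also denote the adjoint pair between $E^\perp$ and $\{E,F\}^\perp$ (note $F\in E^\perp$), and $\tilde\pi_{E'},\iota_{E'}$ denote the adjoint pair between $F^\perp$ and $\{F,E'\}^\perp=\{E,F\}^\perp$. The first relation is between functors $\mathrm{Mod}(Q)\to\{E,F\}^\perp$, the second between functors $\{E,F\}^\perp\to\mathrm{Mod}(Q)$, the third between functors $E^\perp\to F^\perp$. *)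

(* Defs.v *)
From HB Require Import structures.
From mathcomp Require Import all_boot all_order all_algebra.
From mathcomp Require Import mathcomp_extra boolp classical_sets functions.

Set Implicit Arguments.
Unset Strict Implicit.
Unset Printing Implicit Defensive.

Import GRing.Theory.

Local Open Scope ring_scope.
Local Open Scope quotient_scope.

Declare Scope cat_scope.
Delimit Scope cat_scope with cat.

Record quiver := Quiver {
  vertex : finType;
  arrow : finType;
  tail : arrow -> vertex;
  head : arrow -> vertex }.

Section Paths.
Variable Q : quiver.

(* The arrows of a path are listed in the order in which they are traversed;
   [(v, [::])] is the trivial path at [v]. *)
Fixpoint walk (v : vertex Q) (s : seq (arrow Q)) : bool :=
  if s is a :: s' then (tail a == v) && walk (head a) s' else true.

Definition endpoint (v : vertex Q) (s : seq (arrow Q)) : vertex Q :=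
  last v (map (@head Q) s).

Definition qpath := {p : vertex Q * seq (arrow Q) | walk p.1 p.2}.

Definition plen (p : qpath) : nat := size (val p).2.

Lemma walk_cat v s t : walk v (s ++ t) = walk v s && walk (endpoint v s) t.
Proof. by elim: s v => [|a s IH] v //=; rewrite IH andbA. Qed.

Lemma walk_take i (p : qpath) : walk (val p).1 (take i (val p).2).
Proof. by move: (valP p); rewrite -{1}(cat_take_drop i (val p).2) walk_cat => /andP[]. Qed.

Lemma walk_drop i (p : qpath) :
  walk (endpoint (val p).1 (take i (val p).2)) (drop i (val p).2).
Proof. by move: (valP p); rewrite -{1}(cat_take_drop i (val p).2) walk_cat => /andP[]. Qed.

Definition ptake i (p : qpath) : qpath :=
  exist _ ((val p).1, take i (val p).2) (walk_take i p).

Definition pdrop i (p : qpath) : qpath :=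
  exist _ (endpoint (val p).1 (take i (val p).2), drop i (val p).2)
    (walk_drop i p).

Lemma plen_take i p : (i <= plen p)%N -> plen (ptake i p) = i.
Proof. by move=> h; rewrite /plen /= size_takel. Qed.

Lemma plen_drop i p : plen (pdrop i p) = (plen p - i)%N.
Proof. by rewrite /plen /= size_drop. Qed.

Lemma ptake_take i j p : (j <= i)%N -> ptake j (ptake i p) = ptake j p.
Proof. by move=> h; apply: val_inj; rewrite /= take_takel. Qed.

Lemma ptake_drop i j p : ptake j (pdrop i p) = pdrop i (ptake (j + i) p).
Proof.
apply: val_inj; rewrite /= take_drop (take_takel) ?leq_addl //.
Qed.

Lemma endpoint_cat v s t : endpoint v (s ++ t) = endpoint (endpoint v s) t.
Proof. by rewrite /endpoint map_cat last_cat. Qed.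

Lemma pdrop_drop i j p : pdrop j (pdrop i p) = pdrop (j + i) p.
Proof.
apply: val_inj; rewrite /= drop_drop -endpoint_cat.
by rewrite addnC takeD.
Qed.

Lemma ptake_len p : ptake (plen p) p = p.
Proof. by apply: val_inj; rewrite /= take_size; rewrite -surjective_pairing. Qed.

Lemma pdrop0 p : pdrop 0 p = p.
Proof. by apply: val_inj; rewrite /= take0 drop0; rewrite -surjective_pairing. Qed.

End Paths.

Section PathAlgebra.
Variables (k : fieldType) (Q : quiver).

Definition finite_support (x : qpath Q -> k^o) : Prop :=
  exists s : seq (qpath Q), forall p, x p != 0 -> p \in s.

Definition finite_supportb : pred (qpath Q -> k^o) :=
  fun x => `[< finite_support x >].

(* The path algebra [kQ]: finite linear combinations of paths. *)
Record pathalg := PathAlg {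
  coef :> qpath Q -> k^o;
  coefP : finite_supportb coef }.

HB.instance Definition _ := [isSub for coef].
HB.instance Definition _ := [Choice of pathalg by <:].

Lemma finite_support_closed :
  @GRing.subsemimod_closed k (qpath Q -> k^o) finite_supportb.
Proof.
split; first split.
- by apply/asboolP; exists [::] => p; rewrite eqxx.
- move=> x y /asboolP[s hs] /asboolP[t ht]; apply/asboolP.
  exists (s ++ t) => p; rewrite mem_cat; apply: contraR.
  rewrite negb_or => /andP[/(contra (hs p)) + /(contra (ht p))].
  by rewrite !negbK => /eqP xp /eqP yp; rewrite addrfctE xp yp addr0.
- move=> a x /asboolP[s hs]; apply/asboolP; exists s => p.
  by move=> ap; apply: hs; apply: contra ap => /eqP xp; rewrite scalrfctE xp scaler0.
Qed.

HB.instance Definition _ :=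
  GRing.isSubmodClosed.Build k (qpath Q -> k^o) finite_supportb
    finite_support_closed.
HB.instance Definition _ := [SubChoice_isSubLmodule of pathalg by <:].

Lemma pathalgP (x y : pathalg) : (forall p, x p = y p) -> x = y.
Proof. by move=> h; apply: val_inj; apply: funext. Qed.

Lemma coefD (x y : pathalg) p : (x + y) p = x p + y p. Proof. by []. Qed.
Lemma coefZ a (x : pathalg) p : (a *: x) p = a * x p. Proof. by []. Qed.

(* Paths compose like functions: a product [p * q] of paths is [q] followed
   by [p] if [q] ends where [p] starts, and is zero otherwise.  Hence the
   coefficient of a product at [r] is a sum over the factorizations of [r]. *)
Definition convolution (x y : qpath Q -> k^o) (r : qpath Q) : k^o :=
  \sum_(0 <= i < (plen r).+1) x (pdrop i r) * y (ptake i r).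

Definition pconcat (q p : qpath Q) : qpath Q :=
  insubd q ((val q).1, (val q).2 ++ (val p).2).

Lemma pconcat_take_drop i p : pconcat (ptake i p) (pdrop i p) = p.
Proof.
apply: val_inj; rewrite /pconcat val_insubd /= cat_take_drop.
by rewrite (valP p) -surjective_pairing.
Qed.

Lemma convolution_finite (x y : pathalg) : finite_supportb (convolution x y).
Proof.
apply/asboolP; case/asboolP: (coefP x) => s hs; case/asboolP: (coefP y) => t ht.
exists [seq pconcat q p | q <- t, p <- s] => r; apply: contraR => rst.
rewrite /convolution big1 // => i _; apply/eqP; apply: contraR rst.
rewrite mulf_eq0 negb_or => /andP[/hs rs /ht rt]; apply/allpairsP.
by exists (ptake i r, pdrop i r); split=> //=; rewrite pconcat_take_drop.
Qed.

Definition pathalg_mul (x y : pathalg) : pathalg :=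
  PathAlg (convolution_finite x y).

Definition trivial_indicator (p : qpath Q) : k^o := (plen p == 0%N)%:R.

Lemma trivial_indicator_finite : finite_supportb trivial_indicator.
Proof.
apply/asboolP.
exists [seq exist _ (v, [::]) isT : qpath Q | v <- enum (vertex Q)] => p.
rewrite /trivial_indicator /plen; have [sp _|_] := eqVneq (size (val p).2) 0%N; last by rewrite eqxx.
have p0 := size0nil sp.
apply/mapP; exists (val p).1; first by rewrite mem_enum.
by apply: val_inj => /=; rewrite -p0 -surjective_pairing.
Qed.

Definition pathalg_one : pathalg := PathAlg trivial_indicator_finite.

Lemma pathalg_mulA : associative pathalg_mul.
Proof.
move=> x y z; apply: pathalgP => r /=; rewrite /convolution.
transitivity (\sum_(0 <= i < (plen r).+1) \sum_(0 <= j < (plen r).+1 | (j <= i)%N)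
    x (pdrop i r) * y (pdrop j (ptake i r)) * z (ptake j r)).
  rewrite !big_nat; apply: eq_bigr => i /andP[_ ir].
  rewrite mulr_sumr plen_take // (big_nat_widen _ _ (plen r).+1) //.
  apply: eq_bigr => j; rewrite ltnS /= => ji.
  by rewrite ptake_take // mulrA.
rewrite (exchange_big_dep_nat xpredT) //=; apply: eq_big_nat => j /andP[_ jr].
rewrite mulr_suml plen_drop.
transitivity (\sum_(j <= i < (plen r).+1)
    x (pdrop i r) * y (pdrop j (ptake i r)) * z (ptake j r)).
  by rewrite [RHS](big_nat_widenl _ 0).
rewrite -{1}(add0n j) big_addn subSn //.
by apply: eq_bigr => i _; rewrite pdrop_drop ptake_drop.
Qed.

Lemma pathalg_mul1 : left_id pathalg_one pathalg_mul.
Proof.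
move=> x; apply: pathalgP => r /=; rewrite /convolution big_nat_recr //=.
rewrite big_nat big1 ?add0r => [|i /andP[_ ir]].
  by rewrite /trivial_indicator plen_drop subnn eqxx mul1r ptake_len.
by rewrite /trivial_indicator plen_drop subn_eq0 leqNgt ir mul0r.
Qed.

Lemma pathalg_mulr1 : right_id pathalg_one pathalg_mul.
Proof.
move=> x; apply: pathalgP => r /=; rewrite /convolution big_nat_recl //=.
rewrite big_nat big1 ?addr0 => [|i /andP[_ ir]].
  by rewrite /trivial_indicator plen_take // eqxx mulr1 pdrop0.
by rewrite /trivial_indicator plen_take // mulr0.
Qed.

Lemma pathalg_mulDl : left_distributive pathalg_mul +%R.
Proof.
move=> x y z; apply: pathalgP => r; rewrite [RHS]coefD /= /convolution -big_split /=.
by apply: eq_bigr => i _; rewrite mulrDl.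
Qed.

Lemma pathalg_mulDr : right_distributive pathalg_mul +%R.
Proof.
move=> x y z; apply: pathalgP => r; rewrite [RHS]coefD /= /convolution -big_split /=.
by apply: eq_bigr => i _; rewrite mulrDr.
Qed.

(* Only a [pzRingType]: the path algebra of the empty quiver is zero. *)
HB.instance Definition _ :=
  GRing.Zmodule_isPzRing.Build pathalg pathalg_mulA pathalg_mul1 pathalg_mulr1
    pathalg_mulDl pathalg_mulDr.

Lemma pathalg_scaleAl (a : k) (x y : pathalg) : a *: (x * y) = (a *: x) * y.
Proof.
apply: pathalgP => r; rewrite coefZ /= /convolution mulr_sumr.
by apply: eq_bigr => i _; rewrite mulrA.
Qed.

Lemma pathalg_scaleAr (a : k) (x y : pathalg) : a *: (x * y) = x * (a *: y).
Proof.
apply: pathalgP => r; rewrite coefZ /= /convolution mulr_sumr.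
by apply: eq_bigr => i _; rewrite mulrCA.
Qed.

(* The structure map [k -> kQ]. *)
Definition pscalar (a : k) : pathalg := a *: (1 : pathalg).

Lemma pscalarC a (x : pathalg) : pscalar a * x = x * pscalar a.
Proof. by rewrite /pscalar -pathalg_scaleAl mul1r -pathalg_scaleAr mulr1. Qed.

Lemma pscalarM a b : pscalar (a * b) = pscalar a * pscalar b.
Proof. by rewrite /pscalar -pathalg_scaleAl mul1r scalerA. Qed.

Lemma pscalarD a b : pscalar (a + b) = pscalar a + pscalar b.
Proof. exact: scalerDl. Qed.

Lemma pscalar1 : pscalar 1 = 1.
Proof. exact: scale1r. Qed.

End PathAlgebra.

Lemma linearP_eq (R : pzRingType) (U V : lmodType R) (f g : {linear U -> V}) :
  (forall x, f x = g x) -> f = g.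
Proof.
case: f => [f [[cf1] [cf2]]]; case: g => [g [[cg1] [cg2]]] /= /funext fg.
case: _ / fg in cg1 cg2 *.
by rewrite (Prop_irrelevance cf1 cg1) (Prop_irrelevance cf2 cg2).
Qed.

Section LinearZmodule.
Variables (R : pzRingType) (U V : lmodType R).
Implicit Types f g h : {linear U -> V}.

Definition lin_zero : {linear U -> V} := \0.
Definition lin_add f g : {linear U -> V} := f \+ g.
Definition lin_opp f : {linear U -> V} := \- f.

Lemma lin_addA : associative lin_add.
Proof. by move=> f g h; apply: linearP_eq => x /=; rewrite addrA. Qed.
Lemma lin_addC : commutative lin_add.
Proof. by move=> f g; apply: linearP_eq => x /=; rewrite addrC. Qed.
Lemma lin_add0 : left_id lin_zero lin_add.
Proof. by move=> f; apply: linearP_eq => x /=; rewrite add0r. Qed.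
Lemma lin_addN : left_inverse lin_zero lin_opp lin_add.
Proof. by move=> f; apply: linearP_eq => x /=; rewrite addNr. Qed.

HB.instance Definition _ := gen_eqMixin {linear U -> V}.
HB.instance Definition _ := gen_choiceMixin {linear U -> V}.
HB.instance Definition _ :=
  GRing.isZmodule.Build {linear U -> V} lin_addA lin_addC lin_add0 lin_addN.

Lemma lin_addE f g x : (f + g) x = f x + g x. Proof. by []. Qed.
Lemma lin_oppE f x : (- f) x = - f x. Proof. by []. Qed.
Lemma lin_zeroE x : (0 : {linear U -> V}) x = 0. Proof. by []. Qed.

Definition lin_id : {linear U -> U} := idfun.

End LinearZmodule.

Section HomSpace.
Variables (k : fieldType) (Q : quiver) (U V : lmodType (pathalg k Q)).
Implicit Types f g : {linear U -> V}.

Definition lin_scale_fun (a : k) f (x : U) : V := pscalar Q a *: f x.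

Lemma lin_scale_linear a f : linear (lin_scale_fun a f).
Proof.
move=> c x y; rewrite /lin_scale_fun linearP scalerDr !scalerA.
by rewrite pscalarC.
Qed.

HB.instance Definition _ a f :=
  GRing.isLinear.Build (pathalg k Q) U V *:%R (lin_scale_fun a f)
    (lin_scale_linear a f).

Definition lin_scale a f : {linear U -> V} := lin_scale_fun a f.

Lemma lin_scaleA a b f : lin_scale a (lin_scale b f) = lin_scale (a * b) f.
Proof.
by apply: linearP_eq => x; rewrite /= /lin_scale_fun /= /lin_scale_fun scalerA pscalarM.
Qed.
Lemma lin_scale1 : left_id 1 lin_scale.
Proof. by move=> f; apply: linearP_eq => x; rewrite /= /lin_scale_fun pscalar1 scale1r. Qed.
Lemma lin_scaleDr : right_distributive lin_scale +%R.
Proof. by move=> a f g; apply: linearP_eq => x; rewrite /= /lin_scale_fun scalerDr. Qed.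
Lemma lin_scaleDl f : {morph lin_scale^~ f : a b / a + b}.
Proof. by move=> a b; apply: linearP_eq => x; rewrite /= /lin_scale_fun pscalarD scalerDl. Qed.

HB.instance Definition _ :=
  GRing.Zmodule_isLmodule.Build k {linear U -> V}
    lin_scaleA lin_scale1 lin_scaleDr lin_scaleDl.

Lemma lin_scaleE a f x : (a *: f) x = pscalar Q a *: f x. Proof. by []. Qed.

End HomSpace.

Section QuotientModule.
Variables (R : pzRingType) (V : lmodType R) (S : submodClosed V).

Definition submod_pred : {pred V} := fun v => v \in S.

Lemma submod_pred_closed : zmod_closed submod_pred.
Proof.
split=> [|x y Sx Sy]; rewrite -topredE /= /submod_pred ?rpred0 //.
by rewrite -scaleN1r rpredD // rpredZ.
Qed.

HB.instance Definition _ :=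
  GRing.isZmodClosed.Build V submod_pred submod_pred_closed.

Definition lquot := Quotient.quot submod_pred.

HB.instance Definition _ := GRing.Zmodule.on lquot.

Definition lquot_pi (v : V) : lquot := \pi_(Quotient.quot submod_pred) v.

Lemma lquot_piP u v : lquot_pi u = lquot_pi v <-> u - v \in S.
Proof.
have := Quotient.idealrBE submod_pred u v.
rewrite -[_ \in submod_pred]/(u - v \in S) => ->.
by rewrite /lquot_pi; split=> /eqP.
Qed.

Lemma lquot_pi_surj (z : lquot) : exists v, z = lquot_pi v.
Proof. by exists (repr z); rewrite /lquot_pi reprK. Qed.

Lemma lquot_piD u v : lquot_pi (u + v) = lquot_pi u + lquot_pi v.
Proof. exact: raddfD. Qed.

Definition lquot_scale (a : R) (z : lquot) : lquot :=
  lquot_pi (a *: repr (z : Quotient.quot submod_pred)).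

Lemma lquot_scaleE a v : lquot_scale a (lquot_pi v) = lquot_pi (a *: v).
Proof.
apply/lquot_piP; rewrite -scalerBr rpredZ //; apply/lquot_piP.
by rewrite /lquot_pi reprK.
Qed.

Lemma lquot_scaleA a b z : lquot_scale a (lquot_scale b z) = lquot_scale (a * b) z.
Proof. by case: (lquot_pi_surj z) => v ->; rewrite !lquot_scaleE scalerA. Qed.
Lemma lquot_scale1 : left_id 1 lquot_scale.
Proof. by move=> z; case: (lquot_pi_surj z) => v ->; rewrite lquot_scaleE scale1r. Qed.
Lemma lquot_scaleDr : right_distributive lquot_scale +%R.
Proof.
move=> a z w; case: (lquot_pi_surj z) => v ->; case: (lquot_pi_surj w) => u ->.
by rewrite -lquot_piD !lquot_scaleE scalerDr lquot_piD.
Qed.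
Lemma lquot_scaleDl z : {morph lquot_scale^~ z : a b / a + b}.
Proof.
by move=> a b; case: (lquot_pi_surj z) => v ->; rewrite !lquot_scaleE scalerDl lquot_piD.
Qed.

HB.instance Definition _ :=
  GRing.Zmodule_isLmodule.Build R lquot
    lquot_scaleA lquot_scale1 lquot_scaleDr lquot_scaleDl.

End QuotientModule.

Section Modules.
Variables (k : fieldType) (Q : quiver).
Local Notation A := (pathalg k Q).

Definition finitely_generated (M : lmodType A) : Prop :=
  exists (n : nat) (g : 'I_n -> M),
    forall m, exists c : 'rV[A]_n, m = \sum_(i < n) c 0 i *: g i.

Record fgmod := FGMod {
  fgmod_sort :> lmodType A;
  fgmodP : finitely_generated fgmod_sort }.

Section Presentation.
Variable M : fgmod.

Definition ngens : nat := sval (cid (fgmodP M)).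
Definition gens : 'I_ngens -> M := sval (cid (svalP (cid (fgmodP M)))).

Definition pres_fun (c : 'rV[A]_ngens) : M := \sum_(i < ngens) c 0 i *: gens i.

Lemma pres_linear : linear pres_fun.
Proof.
move=> a c d; rewrite /pres_fun scaler_sumr -big_split /=.
by apply: eq_bigr => i _; rewrite !mxE scalerDl scalerA.
Qed.

HB.instance Definition _ :=
  GRing.isLinear.Build A 'rV[A]_ngens M *:%R pres_fun pres_linear.

Lemma pres_surj m : exists c, pres_fun c = m.
Proof.
by have [c ->] := svalP (cid (svalP (cid (fgmodP M)))) m; exists c.
Qed.

Definition syz_pred : pred 'rV[A]_ngens := fun c => pres_fun c == 0.

Lemma syz_closed : @GRing.subsemimod_closed A 'rV[A]_ngens syz_pred.
Proof.
split; first split.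
- by rewrite -topredE /= /syz_pred linear0.
- by move=> c d /eqP hc /eqP hd; rewrite -topredE /= /syz_pred linearD /= hc hd addr0.
- by move=> a c /eqP hc; rewrite -topredE /= /syz_pred linearZ /= hc scaler0.
Qed.

HB.instance Definition _ :=
  GRing.isSubmodClosed.Build A 'rV[A]_ngens syz_pred syz_closed.

(* The kernel of the free cover [pres_fun : kQ^n -> M]. *)
Record syz := Syz { syz_val : 'rV[A]_ngens; syzP : syz_pred syz_val }.

HB.instance Definition _ := [isSub for syz_val].
HB.instance Definition _ := [Choice of syz by <:].
HB.instance Definition _ := [SubChoice_isSubLmodule of syz by <:].

End Presentation.

Section Ext.
Variables M N : fgmod.

Definition extends_pred : {pred {linear syz M -> N}} :=
  fun f => `[< exists g : {linear 'rV[A]_(ngens M) -> N},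
                 forall x : syz M, f x = g (syz_val x) >].

Lemma extends_closed :
  @GRing.subsemimod_closed k {linear syz M -> N} extends_pred.
Proof.
split; first split.
- by apply/asboolP; exists 0 => x; rewrite !lin_zeroE.
- move=> f g /asboolP[f' hf] /asboolP[g' hg]; apply/asboolP; exists (f' + g') => x.
  by rewrite !lin_addE hf hg.
- move=> a f /asboolP[f' hf]; apply/asboolP; exists (a *: f') => x.
  by rewrite !lin_scaleE hf.
Qed.

HB.instance Definition _ :=
  GRing.isSubmodClosed.Build k {linear syz M -> N} extends_pred extends_closed.

(* [Ext^1(M, N)] computed from [0 -> syz M -> kQ^n -> M -> 0], namely
   as the cokernel of [Hom(kQ^n, N) -> Hom(syz M, N)]. *)
Definition Ext : lmodType k := @lquot k {linear syz M -> N} extends_pred.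

Definition Hom : lmodType k := {linear M -> N}.

Definition HomExt : lmodType k := (Hom * Ext)%type.

End Ext.

Definition orth (M N : fgmod) : Prop := forall x : HomExt M N, x = 0.

Definition finite_dim (V : lmodType k) : Prop :=
  exists (n : nat) (b : 'I_n -> V),
    forall v, exists c : 'I_n -> k, v = \sum_(i < n) c i *: b i.

Definition hom_finite (E : fgmod) : Prop :=
  forall X : fgmod, finite_dim (HomExt E X) /\ finite_dim (HomExt X E).

Definition hom_id (E : fgmod) : HomExt E E := (lin_id E, 0).

(* Right and left Hom-finiteness is part of being exceptional. *)
Definition exceptional (E : fgmod) : Prop :=
  [/\ hom_id E != 0,
      forall x : HomExt E E, exists a : k, x = a *: hom_id E
    & hom_finite E].

Definition surjective (U V : Type) (f : U -> V) : Prop := forall y, exists x, f x = y.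

Definition is_kernel (K M N : lmodType A)
    (i : {linear K -> M}) (f : {linear M -> N}) : Prop :=
  injective i /\ forall x, f x = 0 <-> exists y, i y = x.

Definition is_cokernel (M N C : lmodType A)
    (f : {linear M -> N}) (p : {linear N -> C}) : Prop :=
  surjective p /\ forall y, p y = 0 <-> exists x, f x = y.

Definition short_exact (L M N : lmodType A)
    (i : {linear L -> M}) (p : {linear M -> N}) : Prop :=
  is_kernel i p /\ surjective p.

Definition is_zero (M : lmodType A) : Prop := forall x : M, x = 0.

Definition isomorphic (M N : lmodType A) : Prop :=
  exists f : {linear M -> N}, bijective f.

Definition collection := fgmod -> Prop.

Definition single (E : fgmod) : collection := fun M => M = E.
Definition couple (E F : fgmod) : collection := fun M => M = E \/ M = F.

Definition perp (C : collection) : collection :=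
  fun N => forall M, C M -> orth M N.

(* [kQ] need not be noetherian, so [ker f] may fail to be finitely generated:
   closure under kernels concerns the kernels that exist in [Mod(Q)]. *)
Record abelian_closed (P : collection) : Prop := AbelianClosed {
  closed_ker : forall (K M N : fgmod) (i : {linear K -> M}) (f : {linear M -> N}),
    is_kernel i f -> P M -> P N -> P K;
  closed_coker : forall (M N C : fgmod) (f : {linear M -> N}) (p : {linear N -> C}),
    is_cokernel f p -> P M -> P N -> P C;
  closed_ext : forall (L M N : fgmod) (i : {linear L -> M}) (p : {linear M -> N}),
    short_exact i p -> P L -> P N -> P M }.

Definition generated (C : collection) : collection :=
  fun X => forall P : collection,
    abelian_closed P -> (forall M, C M -> P M) -> P X.

(* [u : E^h -> M] is universal when composition with it is an isomorphism
   [Hom(E, E^h) -> Hom(E, M)]. *)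
Definition universal_hom (E M : fgmod) (h : nat)
    (u : {linear {ffun 'I_h -> E} -> M}) : Prop :=
  bijective (fun f : {linear E -> {ffun 'I_h -> E}} => (u \o f : {linear E -> M})).

End Modules.

Record category := Category {
  obj :> Type;
  hom : obj -> obj -> Type;
  idm : forall x, hom x x;
  cmp : forall x y z, hom y z -> hom x y -> hom x z;
  cmp_idl : forall x y (f : hom x y), cmp (idm y) f = f;
  cmp_idr : forall x y (f : hom x y), cmp f (idm x) = f;
  cmpA : forall w x y z (f : hom y z) (g : hom x y) (h : hom w x),
    cmp f (cmp g h) = cmp (cmp f g) h }.

Arguments hom {c} x y.
Arguments idm {c} x.
Arguments cmp {c x y z} f g.

Record functor (C D : category) := Functor {
  fobj :> C -> D;
  fmap : forall x y, hom x y -> hom (fobj x) (fobj y);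
  fmap_id : forall x, fmap (idm x) = idm (fobj x);
  fmap_cmp : forall x y z (f : hom y z) (g : hom x y),
    fmap (cmp f g) = cmp (fmap f) (fmap g) }.

Arguments fmap {C D} _ {x y} _.

Section FunctorComp.
Variables (B C D : category) (G : functor C D) (F : functor B C).

Definition functor_comp : functor B D.
Proof.
refine (@Functor B D (fun x => G (F x)) (fun x y f => fmap G (fmap F f)) _ _).
- by move=> x; rewrite !fmap_id.
- by move=> x y z f g; rewrite !fmap_cmp.
Defined.

End FunctorComp.

Notation "G ∘ F" := (functor_comp G F)
  (at level 40, left associativity) : cat_scope.

Definition natural (C D : category) (F G : functor C D)
    (a : forall x, hom (F x) (G x)) : Prop :=
  forall x y (f : hom x y), cmp (a y) (fmap F f) = cmp (fmap G f) (a x).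

Definition nat_iso (C D : category) (F G : functor C D) : Prop :=
  exists (a : forall x, hom (F x) (G x)) (b : forall x, hom (G x) (F x)),
    [/\ natural a, natural b,
        forall x, cmp (a x) (b x) = idm (G x)
      & forall x, cmp (b x) (a x) = idm (F x)].

Notation "F ≅ G" := (nat_iso F G) (at level 70) : cat_scope.

Record adjunction (C D : category) (L : functor C D) (R : functor D C) := Adjunction {
  transpose : forall (x : C) (y : D), hom (L x) y -> hom x (R y);
  transpose_bij : forall x y, bijective (@transpose x y);
  transpose_natl : forall (x x' : C) (y : D) (f : hom x' x) (g : hom (L x) y),
    transpose (cmp g (fmap L f)) = cmp (transpose g) f;
  transpose_natr : forall (x : C) (y y' : D) (h : hom y y') (g : hom (L x) y),
    transpose (cmp h g) = cmp (fmap R h) (transpose g) }.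

Record left_adjoint (C D : category) (R : functor D C) := LeftAdjoint {
  ladj :> functor C D;
  ladj_adjunction : adjunction ladj R }.

Definition full_subcategory (C : category) (P : C -> Prop) : category.
Proof.
refine (@Category {x : C | P x} (fun x y => hom (sval x) (sval y))
  (fun x => idm (sval x)) (fun x y z f g => cmp f g) _ _ _).
- by move=> x y f; rewrite cmp_idl.
- by move=> x y f; rewrite cmp_idr.
- by move=> w x y z f g h; rewrite cmpA.
Defined.

Definition full_incl (C : category) (P : C -> Prop) :
  functor (full_subcategory P) C.
Proof.
by refine (@Functor (full_subcategory P) C (fun x => sval x) (fun x y f => f) _ _).
Defined.

Definition sub_incl (C : category) (P P' : C -> Prop) (PP' : forall x, P x -> P' x) :
  functor (full_subcategory P) (full_subcategory P').
Proof.
by refine (@Functor (full_subcategory P) (full_subcategory P')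
  (fun x => exist _ (sval x) (PP' _ (svalP x))) (fun x y f => f) _ _).
Defined.

Section PerpCategories.
Variables (k : fieldType) (Q : quiver).

Definition Mod : category.
Proof.
refine (@Category (fgmod k Q) (fun M N => {linear M -> N})
  (fun M => lin_id M) (fun L M N g f => (g \o f : {linear L -> N})) _ _ _).
- by move=> M N f; apply: linearP_eq.
- by move=> M N f; apply: linearP_eq.
- by move=> L M N P f g h; apply: linearP_eq.
Defined.

Definition perp_cat (C : collection k Q) : category :=
  @full_subcategory Mod (perp C).

Lemma perp_couplel (E F X : fgmod k Q) : perp (couple E F) X -> perp (single E) X.
Proof. by move=> h M ->; apply: h; left. Qed.

Definition iota1 (E : fgmod k Q) : functor (perp_cat (single E)) Mod :=
  @full_incl Mod (perp (single E)).

Definition iota2 (E F : fgmod k Q) :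
    functor (perp_cat (couple E F)) (perp_cat (single E)) :=
  @sub_incl Mod _ _ (@perp_couplel E F).

(* The identity on modules and homomorphisms; it is needed since [perp C] and
   [perp C'] index distinct types even when they have the same members. *)
Definition perp_ident (C C' : collection k Q)
    (CC' : forall X, perp C X <-> perp C' X) : functor (perp_cat C) (perp_cat C') :=
  @sub_incl Mod _ _ (fun X => proj1 (CC' X)).

(* [E'] is, up to isomorphism, the kernel of the universal homomorphism
   [E^h -> M] if the projection of [M] to [E^perp] vanishes, and that
   projection otherwise. *)
Definition is_varpi (E : fgmod k Q) (piE : left_adjoint (iota1 E))
    (M E' : fgmod k Q) : Prop :=
  let P : fgmod k Q := sval (piE M) in
  (is_zero P /\
     exists (h : nat) (u : {linear {ffun 'I_h -> E} -> M})
            (j : {linear E' -> {ffun 'I_h -> E}}),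
       universal_hom u /\ is_kernel j u)
  \/ (~ is_zero P /\ isomorphic E' P).

End PerpCategories.

(* Main.v *)
From HB Require Import structures.
Require Import Defs.
From mathcomp Require Import all_boot all_algebra.
From mathcomp Require Import boolp classical_sets functions.

(* Write [Hom*] for [Hom + Ext].  The path algebra is free over its vertices on
   its arrows, so cocycles integrate over free modules; this makes kernels of
   covers by free modules projective, and [Ext] right exact in both variables.
   All dimension counts then come from the long exact sequences.

   Let [u : F^h -> E] be the universal homomorphism, [K], [I], [C] its kernel,
   image and cokernel.  Universality gives [Hom(F, K) = 0] and [Hom(F, C) = 0];
   killing [Ext(F, C)] by iterated extensions by [F] gives the reflection [T]
   of [E] into the right orthogonal of [F].  Since [E] is left orthogonal to
   [F], [Hom(E, I) = Ext(E, K)]: if it is non-zero then [I = E], and otherwise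
   [Ext(I, K) = 0], [K] is a summand of [F^h], and [K = 0].  So [u] is surjective
   and [E' = K], or injective and [E' = T].  In both cases [E'] is obtained from
   [E] and [F] by short exact sequences, whence every class of modules with the
   two-out-of-three property that contains [F] contains [E] iff it contains
   [E'].  This gives equality of the generated subcategories, equality of the
   orthogonals and finiteness of [Hom*]; [E'] is exceptional by counting
   dimensions.  The functors in the relations are relative left adjoints of the
   same inclusions, since the reflection of a module of the right orthogonal of
   [E] into that of [F] stays right orthogonal to [E]. *)

Set Implicit Arguments.
Unset Strict Implicit.
Unset Printing Implicit Defensive.

Import GRing.Theory.
Local Open Scope ring_scope.

(** * Codimension of subspaces and exactness *)

Lemma split_lshift m n (i : 'I_m) : fintype.split (lshift n i) = inl i.
Proof. exact: (unsplitK (inl i)). Qed.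

Lemma split_rshift m n (i : 'I_n) : fintype.split (rshift m i) = inr i.
Proof. exact: (unsplitK (inr i)). Qed.

Section Codimension.
Variable k : fieldType.

Definition subspace (V : lmodType k) (S : V -> Prop) : Prop :=
  S 0 /\ forall a u v, S u -> S v -> S (a *: u + v).

Lemma subspaceD (V : lmodType k) (S : V -> Prop) u v :
  subspace S -> S u -> S v -> S (u + v).
Proof. by move=> [_ h] Su Sv; rewrite -[u]scale1r; apply: h. Qed.

Lemma subspaceZ (V : lmodType k) (S : V -> Prop) a u :
  subspace S -> S u -> S (a *: u).
Proof. by move=> [h0 h] Su; rewrite -[_ *: _]addr0; apply: h. Qed.

Lemma subspaceB (V : lmodType k) (S : V -> Prop) u v :
  subspace S -> S u -> S v -> S (u - v).
Proof.
by move=> hS Su Sv; apply: subspaceD => //; rewrite -scaleN1r; apply: subspaceZ.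
Qed.

Lemma subspace_sum (V : lmodType k) (S : V -> Prop) (I : finType) (c : I -> k)
  (b : I -> V) : subspace S -> (forall i, S (b i)) -> S (\sum_i c i *: b i).
Proof.
move=> hS hb; apply: big_ind => [|u v|i _]; first by case: hS.
  exact: subspaceD.
exact: subspaceZ.
Qed.

(** Take a matrix of maximal rank with rows in [W]: a vector of [W] outside its row space would,
    once added, raise the rank. *)
Lemma subspace_span (m : nat) (W : 'rV[k]_m -> Prop) : subspace W ->
  exists r : 'I_m -> 'rV[k]_m, (forall i, W (r i)) /\
    forall w, W w -> exists d : 'I_m -> k, w = \sum_i d i *: r i.
Proof.
move=> hW.
have Wmul p q (D : 'M[k]_(p, q)) (A : 'M_(q, m)) i :
    (forall j, W (row j A)) -> W (row i (D *m A)).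
  by move=> hA; rewrite row_mul mulmx_sum_row; apply: subspace_sum.
pose P n := `[< exists M : 'M[k]_m, (forall i, W (row i M)) /\ \rank M = n >].
have P0 : exists n, P n.
  by exists 0%N; apply/asboolP; exists 0; split=> [i|]; rewrite ?mxrank0 // row0; case: hW.
have Pm n : P n -> (n <= m)%N.
  by move=> /asboolP [M [_ <-]]; apply: rank_leq_col.
case: (ex_maxnP P0 Pm) => n /asboolP [M [hM rM]] maxn.
exists (fun i => row i M); split=> // w Ww.
have [/submxP[D ->]|nwM] := boolP (w <= M)%MS.
  by exists (fun i => D 0 i); rewrite mulmx_sum_row.
have : (\rank (w + M)%MS <= n)%N.
  apply: maxn; apply/asboolP; exists (w + M)%MS; split=> // i.
  have /submxP[D ->] : (row i (w + M)%MS <= col_mx w M)%MS.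
    by rewrite (submx_trans (row_sub _ _)) // addsmxE.
  rewrite -[D *m _](row_id 0); apply: (Wmul) => j.
  rewrite -[j]fintype.splitK; case: (fintype.split j) => j'; first by rewrite /= rowKu row_id.
  by rewrite /= rowKd.
have sM : (M <= w + M)%MS by apply: addsmxSr.
rewrite -rM => le; have := mxrank_leqif_sup sM => -[_ /esym].
have /eqP -> : \rank M == \rank (w + M)%MS by rewrite eqn_leq le mxrankS.
by rewrite eqxx addsmx_sub (negPf nwM).
Qed.

(* [cod n S]: the quotient of [V] by [S] has dimension at most [n]. *)
Definition cod n (V : lmodType k) (S : V -> Prop) : Prop :=
  exists b : 'I_n -> V, forall v, exists c : 'I_n -> k, S (v - \sum_i c i *: b i).

Lemma cod_sub n (V : lmodType k) (S S' : V -> Prop) :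
  (forall v, S v -> S' v) -> cod n S -> cod n S'.
Proof. by move=> SS' [b hb]; exists b => v; have [c /SS'] := hb v; exists c. Qed.

Lemma cod0 (V : lmodType k) (S : V -> Prop) : (forall v, S v) -> cod 0 S.
Proof. by move=> hS; exists (fun=> 0) => v; exists (fun=> 0). Qed.

Lemma cod0E (V : lmodType k) (S : V -> Prop) v : cod 0 S -> S v.
Proof. by move=> [b hb]; have [c] := hb v; rewrite big_ord0 subr0. Qed.

Lemma cod_mono n m (V : lmodType k) (S : V -> Prop) : (n <= m)%N ->
  cod n S -> cod m S.
Proof.
move=> /subnKC <- [b hb].
exists (fun i => match fintype.split i with inl i => b i | inr _ => 0 end) => v.
have [c hc] := hb v.
exists (fun i => match fintype.split i with inl i => c i | inr _ => 0 end).
rewrite big_split_ord /= [X in _ - (_ + X)]big1 => [|i _]; last by rewrite split_rshift scaler0.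
by under eq_bigr do rewrite split_lshift; rewrite addr0.
Qed.

Lemma cod_basis n (V : lmodType k) (S : V -> Prop) : subspace S -> cod n S ->
  exists m (b : 'I_m -> V), [/\ (m <= n)%N,
    forall v, exists c : 'I_m -> k, S (v - \sum_i c i *: b i) &
    forall c : 'I_m -> k, S (\sum_i c i *: b i) -> forall i, c i = 0].
Proof.
move=> hS; elim: n => [|n IH] hn.
  by have [b hb] := hn; exists 0%N, b; split=> // c _ [].
have [b hb] := hn.
have [ind|] := pselect (forall c : 'I_n.+1 -> k, S (\sum_i c i *: b i) -> forall i, c i = 0).
  by exists n.+1, b; split=> //; apply: leqnn.
move=> /existsNP [c /not_implyP [Sc /existsNP [i0 /eqP ci0]]].
suff: cod n S by move=> /IH [m [b' [le h1 h2]]]; exists m, b'; split=> //; apply: leqW.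
exists (fun j => b (lift i0 j)) => v.
have [d Sd] := hb v.
(* Adding [t] times the relation to the remainder cancels the coefficient at [i0]. *)
pose t := d i0 / c i0.
exists (fun j => d (lift i0 j) - t * c (lift i0 j)).
have -> : v - \sum_i (d (lift i0 i) - t * c (lift i0 i)) *: b (lift i0 i) =
    (v - \sum_i d i *: b i) + t *: \sum_i c i *: b i.
  rewrite -addrA; congr (v + _).
  rewrite (bigD1_ord i0) //= [X in t *: X](bigD1_ord i0) //=.
  rewrite scalerDr scalerA divfK // opprD addrACA addNr add0r scaler_sumr.
  rewrite -!sumrN addrC -big_split /=; apply: eq_bigr => i _.
  by rewrite scalerBl opprB scalerA.
by apply: subspaceD => //; apply: subspaceZ.
Qed.

Definition linear_rel (V W : lmodType k) (F : V -> W -> Prop) : Prop :=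
  [/\ F 0 0,
      forall a v v' w w', F v w -> F v' w' -> F (a *: v + v') (a *: w + w') &
      forall v, exists w, F v w].

Lemma linear_rel_sum (V W : lmodType k) (F : V -> W -> Prop) (I : finType)
    (c : I -> k) v w :
  linear_rel F -> (forall i, F (v i) (w i)) ->
  F (\sum_i c i *: v i) (\sum_i c i *: w i).
Proof.
move=> [F0 FD _] h; apply: (big_ind2 F) => // [x1 x2 y1 y2 h1 h2|i _].
  by rewrite -[x1]scale1r -[x2]scale1r; apply: FD.
by rewrite -[_ *: v i]addr0 -[_ *: w i]addr0; apply: FD.
Qed.

Lemma linear_relB (V W : lmodType k) (F : V -> W -> Prop) v v' w w' :
  linear_rel F -> F v w -> F v' w' -> F (v - v') (w - w').
Proof.
move=> [F0 FD _] h h'; rewrite addrC [w - _]addrC -!scaleN1r.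
exact: FD.
Qed.

(* If [U/R -> V/S -> W/T] is exact at [V/S], then
   [dim V/S <= dim U/R + dim W/T].  The two maps are only given as relations
   because connecting homomorphisms depend on choices of lifts. *)
Lemma cod_exact n m (U V W : lmodType k) (R : U -> Prop) (S : V -> Prop)
    (T : W -> Prop) (F : U -> V -> Prop) (G : V -> W -> Prop) :
  subspace S -> subspace T -> linear_rel F -> linear_rel G ->
  (forall u v, F u v -> R u -> S v) ->
  (forall v w, G v w -> T w -> exists u v', F u v' /\ S (v - v')) ->
  cod n R -> cod m T -> cod (n + m) S.
Proof.
move=> hS hT hF hG FRS GTS [b hb] [d hd].
have Ftot : forall u, exists v, F u v by case: hF.
have Gtot : forall v, exists w, G v w by case: hG.
(* [W0] is the preimage in [k^m], under the coordinates [d], of the image of [G] modulo [T]. Its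
   spanning rows [r] have lifts [vr] in [V]. *)
pose W0 (c : 'rV[k]_m) := exists v w, G v w /\ T (w - \sum_i c 0 i *: d i).
have sW0 : subspace W0.
  split.
    exists 0, 0; split; first by case: hG.
    by rewrite big1 => [|i _]; rewrite ?mxE ?scale0r // subr0; case: hT.
  move=> a x y [v [w [Gvw Tw]]] [v' [w' [Gvw' Tw']]].
  exists (a *: v + v'), (a *: w + w'); split; first by case: hG => _ h _; apply: h.
  have -> : a *: w + w' - \sum_i (a *: x + y) 0 i *: d i =
      a *: (w - \sum_i x 0 i *: d i) + (w' - \sum_i y 0 i *: d i).
    rewrite scalerBr scaler_sumr addrACA -opprD -big_split /=.
    by congr (_ - _); apply: eq_bigr => i _; rewrite !mxE scalerDl scalerA.
  by case: hT => _; apply.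
have [r [Wr spanr]] := subspace_span sW0.
have [vr hvr] := choice Wr.
have [wr {}hvr] := choice hvr.
have [fb hfb] := choice (fun i => Ftot (b i)).
exists (fun i => match fintype.split i with inl i => fb i | inr j => vr j end) => v.
have [w Gvw] := Gtot v.
have [c Tc] := hd w.
have /spanr [e he] : W0 (\row_i c i).
  by exists v, w; split=> //; under eq_bigr do rewrite mxE.
(* Subtracting the lifts [vr] moves the value of [G] into [T], where exactness applies; what remains
   comes from [U] and is spanned by the [fb]. *)
have [u [v' [Fuv' Sv']]] : exists u v', F u v' /\ S (v - \sum_j e j *: vr j - v').
  apply: (GTS _ (w - \sum_j e j *: wr j)).
    apply: linear_relB => //; apply: linear_rel_sum => // i.
    by case: (hvr i).
  have -> : w - \sum_j e j *: wr j = (w - \sum_i c i *: d i) -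
      \sum_j e j *: (wr j - \sum_i r j 0 i *: d i).
    transitivity (w - \sum_i c i *: d i - (\sum_j e j *: wr j - \sum_i c i *: d i)).
      by rewrite opprB addrA subrK.
    congr (_ - _); under [in RHS]eq_bigr do rewrite scalerBr.
    rewrite [RHS]big_split /= sumrN; congr (_ - _).
    under [RHS]eq_bigr do rewrite scaler_sumr.
    rewrite exchange_big /=; apply: eq_bigr => i _.
    under eq_bigr do rewrite scalerA.
    rewrite -scaler_suml; congr (_ *: _).
    by move/rowP: he => /(_ i); rewrite mxE summxE => ->; apply: eq_bigr => j _; rewrite mxE.
  by apply: subspaceB => //; apply: subspace_sum => // j; case: (hvr j).
have [a ha] := hb u.
exists (fun i => match fintype.split i with inl i => a i | inr j => e j end).
rewrite big_split_ord /=.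
under eq_bigr do rewrite split_lshift.
under [X in _ - (_ + X)]eq_bigr do rewrite split_rshift.
have -> : v - (\sum_i a i *: fb i + \sum_j e j *: vr j) =
    (v - \sum_j e j *: vr j - v') + (v' - \sum_i a i *: fb i).
  by rewrite addrA subrK opprD addrA addrAC.
apply: subspaceD => //; apply: FRS ha; apply: linear_relB => //.
exact: linear_rel_sum.
Qed.

Lemma cod_exact0r n (U V : lmodType k) (R : U -> Prop) (S : V -> Prop)
    (F : U -> V -> Prop) :
  subspace S -> linear_rel F ->
  (forall u v, F u v -> R u -> S v) ->
  (forall v, exists u v', F u v' /\ S (v - v')) -> cod n R -> cod n S.
Proof.
move=> hS hF FRS Fsurj hn; rewrite -[n]addn0.
apply: (@cod_exact n 0 U V k^o R S (fun=> True) F (fun _ w => w = 0)) => //.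
- by split=> // [a v v' w w' -> ->|v]; [rewrite scaler0 addr0|exists 0].
- exact: cod0.
Qed.

Lemma cod_exact0l n (V W : lmodType k) (S : V -> Prop) (T : W -> Prop)
    (G : V -> W -> Prop) :
  subspace S -> subspace T -> linear_rel G ->
  (forall v w, G v w -> T w -> S v) -> cod n T -> cod n S.
Proof.
move=> hS hT hG GTS hn; rewrite -[n]add0n.
apply: (@cod_exact 0 n k^o V W (fun=> True) S T (fun _ v => v = 0) G) => //.
- by split=> // [a v v' w w' -> ->|v]; [rewrite scaler0 addr0|exists 0].
- by move=> u v ->; case: hS.
- by move=> v w /GTS h /h Sv; exists 0, 0; rewrite subr0.
- exact: cod0.
Qed.

End Codimension.

(** * Kernels and cokernels *)

Section MakeLinear.
Variables (R : pzRingType) (U V : lmodType R) (f : U -> V) (lin_f : linear f).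

(** The proof argument lets a linear structure be attached to a function whose linearity is known
    only from a local hypothesis. *)
Definition linear_fun of linear f : U -> V := f.

HB.instance Definition _ :=
  GRing.isLinear.Build R U V *:%R (linear_fun lin_f) lin_f.

Definition make_linear : {linear U -> V} := linear_fun lin_f.

End MakeLinear.

Section Modules.
Variables (k : fieldType) (Q : quiver).
Local Notation R := (pathalg k Q).
Implicit Types U V W : lmodType R.

Lemma factor_surj U V W (p : {linear U -> V}) (f : {linear U -> W}) :
  Defs.surjective p -> (forall x, p x = 0 -> f x = 0) ->
  exists g : {linear V -> W}, forall x, g (p x) = f x.
Proof.
move=> ps pf; have [s sP] := choice ps.
have fE x y : p x = p y -> f x = f y.
  move=> pxy; apply/eqP; rewrite -subr_eq0 -linearB; apply/eqP/pf.
  by rewrite linearB /= pxy subrr.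
have lin : linear (f \o s).
  by move=> a x y /=; rewrite -linearP; apply: fE; rewrite linearP !sP.
by exists (make_linear lin) => x /=; apply: fE; rewrite sP.
Qed.

Lemma factor_inj U V W (i : {linear U -> V}) (f : {linear W -> V}) :
  injective i -> (forall x, exists y, i y = f x) ->
  exists g : {linear W -> U}, forall x, i (g x) = f x.
Proof.
move=> ii fi; have [s sP] := choice fi.
have lin : linear s by move=> a x y; apply: ii; rewrite linearP !sP linearP.
by exists (make_linear lin).
Qed.

Lemma linear_injP U V (f : {linear U -> V}) :
  (forall x, f x = 0 -> x = 0) -> injective f.
Proof.
move=> h x y fxy; apply/eqP; rewrite -subr_eq0; apply/eqP/h.
by rewrite linearB /= fxy subrr.
Qed.

Section Kernel.
Variables (U V : lmodType R) (f : {linear U -> V}).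

Definition ker_pred : pred U := fun x => f x == 0.

Lemma ker_pred_closed : @GRing.subsemimod_closed R U ker_pred.
Proof.
split; first split.
- by rewrite -topredE /= /ker_pred linear0.
- by move=> x y /eqP hx /eqP hy; rewrite -topredE /= /ker_pred linearD /= hx hy addr0.
- by move=> a x /eqP hx; rewrite -topredE /= /ker_pred linearZ /= hx scaler0.
Qed.

HB.instance Definition _ := GRing.isSubmodClosed.Build R U ker_pred ker_pred_closed.

Record kernel := Kernel { kernel_val : U; kernelP : ker_pred kernel_val }.

HB.instance Definition _ := [isSub for kernel_val].
HB.instance Definition _ := [Choice of kernel by <:].
HB.instance Definition _ := [SubChoice_isSubLmodule of kernel by <:].

Lemma kernel_val_linear : linear kernel_val. Proof. by []. Qed.

Lemma kernel_val_is_kernel : is_kernel (make_linear kernel_val_linear) f.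
Proof.
split=> [|x]; first exact: val_inj.
split=> [fx|[y <-]]; last exact/eqP/kernelP.
have kx : ker_pred x by apply/eqP.
by exists (Kernel kx).
Qed.

End Kernel.

Lemma kernel_exists U V (f : {linear U -> V}) :
  exists (K : lmodType R) (i : {linear K -> U}), is_kernel i f.
Proof. by exists (kernel f : lmodType R); eexists; apply: kernel_val_is_kernel. Qed.

Section Cokernel.
Variables (U V : lmodType R) (f : {linear U -> V}).

Definition im_pred : {pred V} := fun y => `[< exists x, f x = y >].

Lemma im_pred_closed : @GRing.subsemimod_closed R V im_pred.
Proof.
split; first split.
- by apply/asboolP; exists 0; rewrite linear0.
- move=> x y /asboolP[x' <-] /asboolP[y' <-]; apply/asboolP.
  by exists (x' + y'); rewrite linearD.
- by move=> a x /asboolP[x' <-]; apply/asboolP; exists (a *: x'); rewrite linearZ.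
Qed.

HB.instance Definition _ := GRing.isSubmodClosed.Build R V im_pred im_pred_closed.

Lemma coker_proj_linear : linear (@lquot_pi R V im_pred).
Proof. by move=> a x y; rewrite lquot_piD -lquot_scaleE. Qed.

Lemma coker_proj_is_cokernel : is_cokernel f (make_linear coker_proj_linear).
Proof.
split=> [z|y]; first by have [v ->] := lquot_pi_surj z; exists v.
rewrite -[0](linear0 (make_linear coker_proj_linear)).
split; first by move/lquot_piP; rewrite subr0 => /asboolP.
by move=> h; apply/lquot_piP; rewrite subr0; apply/asboolP.
Qed.

End Cokernel.

Lemma cokernel_exists U V (f : {linear U -> V}) :
  exists (C : lmodType R) (q : {linear V -> C}), is_cokernel f q.
Proof. by eexists; eexists; apply: coker_proj_is_cokernel. Qed.

End Modules.

(** * The basis of paths *)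

Section Paths.
Variables (k : fieldType) (Q : quiver).
Local Notation A := (pathalg k Q).

Lemma path_elt_finite (p : qpath Q) :
  finite_supportb (fun q => (q == p)%:R : k^o).
Proof. by apply/asboolP; exists [:: p] => q; rewrite inE; apply: contraR => /negPf ->; rewrite mulr0n. Qed.

Definition path_elt (p : qpath Q) : A := PathAlg (path_elt_finite p).

Lemma path_eltE p q : path_elt p q = (q == p)%:R. Proof. by []. Qed.

Lemma coef_sum (I : Type) (r : seq I) (F : I -> A) q :
  (\sum_(i <- r) F i) q = \sum_(i <- r) F i q.
Proof. by elim/big_rec2: _ => // i x y _ <-. Qed.

Lemma supp_exists (x : A) : exists s : seq (qpath Q), uniq s /\ forall p, x p != 0 -> p \in s.
Proof.
have /asboolP [s hs] := coefP x; exists (undup s); split; first exact: undup_uniq.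
by move=> p /hs; rewrite mem_undup.
Qed.

Lemma path_elt_sum (x : A) (s : seq (qpath Q)) : uniq s ->
  (forall p, x p != 0 -> p \in s) -> x = \sum_(p <- s) (x p : k) *: path_elt p.
Proof.
move=> us hs; apply: pathalgP => q; rewrite coef_sum.
under eq_bigr do rewrite Defs.coefZ path_eltE.
have [qs|qs] := boolP (q \in s).
  rewrite (bigD1_seq q) //= eqxx mulr1 big1 ?addr0 // => p /negPf pq.
  by rewrite eq_sym pq mulr0.
have -> : x q = 0 by apply/eqP; apply: contraR qs => /hs.
rewrite big_seq big1 // => p ps.
by case: eqP => [qp|]; [rewrite qp ps in qs|rewrite mulr0].
Qed.

(** Of all the cuts of [r] in the convolution, only the one at [plen q] can have [q] as its first
    piece. *)
Lemma coef_mul_path (x : A) q r :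
  (x * path_elt q) r =
  if (plen q <= plen r)%N && (ptake (plen q) r == q) then x (pdrop (plen q) r) else 0.
Proof.
rewrite [LHS]/(convolution x (path_elt q) r) /convolution.
have [le|gt] /= := leqP (plen q) (plen r); last first.
  rewrite big_nat big1 // => i /andP [_ ir]; rewrite ?path_eltE.
  case: eqP => [e|]; last by rewrite mulr0.
  by move: gt; rewrite -e plen_take // ltnNge; move: ir; rewrite ltnS => ->.
rewrite (bigD1_seq (plen q)) ?mem_index_iota ?iota_uniq //= ?path_eltE.
rewrite big_seq_cond big1 ?addr0 => [|i /andP [ir iq]].
  by case: eqP; rewrite ?mulr1 ?mulr0.
rewrite ?path_eltE; case: eqP => [e|]; last by rewrite mulr0.
by move: iq; rewrite -e plen_take ?eqxx //; move: ir; rewrite mem_index_iota /= ltnS.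
Qed.

Definition path_end (p : qpath Q) := endpoint (val p).1 (val p).2.

Lemma mul_path0 p q : path_end q != (val p).1 -> path_elt p * path_elt q = 0.
Proof.
move=> ne; apply: pathalgP => r; rewrite coef_mul_path; case: ifP => // /andP [_ /eqP e].
rewrite path_eltE; case: eqP => // e'; move: ne.
by rewrite -e' -{1}e /path_end /= eqxx.
Qed.

Lemma mul_path p q : path_end q = (val p).1 ->
  path_elt p * path_elt q = path_elt (pconcat q p).
Proof.
move=> e; apply: pathalgP => r; rewrite coef_mul_path !path_eltE.
have vc : val (pconcat q p) = ((val q).1, (val q).2 ++ (val p).2).
  rewrite /pconcat val_insubd /= walk_cat (valP q) -[endpoint _ _]/(path_end q) e.
  by rewrite (valP p).
have [->|ne] := eqVneq r (pconcat q p).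
  have -> : (plen q <= plen (pconcat q p))%N by rewrite /plen vc /= size_cat leq_addr.
  have -> : ptake (plen q) (pconcat q p) == q.
    apply/eqP/val_inj; rewrite /= vc /= /plen take_size_cat //.
    by rewrite -surjective_pairing.
  have -> : pdrop (plen q) (pconcat q p) == p.
    apply/eqP/val_inj; rewrite /= vc /= /plen take_size_cat // drop_size_cat //.
    by rewrite -[endpoint _ _]/(path_end q) e -surjective_pairing.
  by [].
case: ifP => // /andP [_ /eqP tq]; case: eqP => // dp.
by case/eqP: ne; rewrite -{1}[r](pconcat_take_drop (plen q)) tq dp.
Qed.

Definition vtx (v : vertex Q) : A := path_elt (exist _ (v, [::]) isT).

Lemma walk_arrow (a : arrow Q) : walk (tail a) [:: a].
Proof. by rewrite /= eqxx. Qed.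

Definition arr (a : arrow Q) : A := path_elt (exist _ (tail a, [:: a]) (walk_arrow a)).

Lemma sum_vtx : \sum_v vtx v = 1.
Proof.
apply: pathalgP => r; rewrite coef_sum [RHS]/(trivial_indicator k r).
rewrite /trivial_indicator; under eq_bigr do rewrite path_eltE.
have [r0|r0] := eqVneq (plen r) 0%N.
  have e : r = exist _ ((val r).1, [::]) isT.
    by apply: val_inj; rewrite /= -(size0nil r0) -surjective_pairing.
  rewrite (bigD1 (val r).1) //= {1}e eqxx big1 ?addr0 // => v vr.
  by case: eqP => // e'; rewrite e' /= eqxx in vr.
by rewrite big1 // => v _; case: eqP => // e; rewrite e in r0.
Qed.

Lemma vtx_path p : vtx (path_end p) * path_elt p = path_elt p.
Proof.
rewrite /vtx mul_path //; congr path_elt; apply: val_inj.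
by rewrite /pconcat val_insubd /= cats0 (valP p) -surjective_pairing.
Qed.

Lemma vtx_path0 v p : path_end p != v -> vtx v * path_elt p = 0.
Proof. exact: (@mul_path0 (exist _ (v, [::]) isT) p). Qed.

Lemma vtx_idem v : vtx v * vtx v = vtx v.
Proof. exact: (vtx_path (exist _ (v, [::]) isT)). Qed.

Lemma vtx_orth v w : v != w -> vtx v * vtx w = 0.
Proof. by move=> vw; apply: vtx_path0; rewrite eq_sym. Qed.

Lemma vtx_arr a : vtx (Defs.head a) * arr a = arr a.
Proof. exact: (vtx_path (exist _ (tail a, [:: a]) (walk_arrow a))). Qed.

Lemma arr_vtx a : arr a * vtx (tail a) = arr a.
Proof.
rewrite [LHS]mul_path //; congr path_elt; apply: val_inj.
by rewrite /pconcat val_insubd /= eqxx.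
Qed.

Lemma arr_path a (p q : qpath Q) : path_end p = tail a ->
  val q = ((val p).1, rcons (val p).2 a) -> arr a * path_elt p = path_elt q.
Proof.
move=> e vq; rewrite mul_path //; congr path_elt; apply: val_inj.
by have := valP q; rewrite /pconcat val_insubd vq /= cats1 => ->.
Qed.

(** Induction on the last arrow traversed, because left multiplication by an arrow prolongs a path
    at its end. *)
Lemma path_ind (P : qpath Q -> Prop) :
  (forall v, P (exist _ (v, [::]) isT)) ->
  (forall p q a, P p -> path_end p = tail a ->
    val q = ((val p).1, rcons (val p).2 a) -> P q) -> forall p, P p.
Proof.
move=> P0 PS [[v s] /= w]; elim/last_ind: s w => [|s a IH] w.
  by rewrite (bool_irrelevance w isT).
have /andP [ws /eqP e] : walk v s && (tail a == endpoint v s).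
  by move: (w); rewrite -cats1 walk_cat /= andbT.
by apply: (PS (exist _ (v, s) ws) _ a (IH ws)).
Qed.

Lemma pathalg_ind (P : A -> Prop) : P 0 -> (forall x y, P x -> P y -> P (x + y)) ->
  (forall c x, P x -> P (c *: x)) -> (forall p, P (path_elt p)) -> forall x, P x.
Proof.
move=> P0 PD PZ Pp x; have [s [us hs]] := supp_exists x.
by rewrite (path_elt_sum us hs); apply: big_ind => // p _; apply: PZ.
Qed.

Lemma pathalg_gen (P : A -> Prop) : P 0 -> (forall x y, P x -> P y -> P (x + y)) ->
  (forall c x, P x -> P (c *: x)) -> (forall x y, P x -> P y -> P (x * y)) ->
  (forall v, P (vtx v)) -> (forall a, P (arr a)) -> forall x, P x.
Proof.
move=> P0 PD PZ PM Pv Pa; apply: pathalg_ind => //; apply: path_ind => // p q a Pp e vq.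
by rewrite -(arr_path e vq); apply: PM.
Qed.

Lemma pscalarZ (V : lmodType A) (c : k) (x : A) (v : V) :
  (c *: x) *: v = pscalar Q c *: (x *: v).
Proof. by rewrite scalerA /pscalar -pathalg_scaleAl mul1r. Qed.

Lemma pscalar_comm (V : lmodType A) (c : k) (x : A) (v : V) :
  x *: (pscalar Q c *: v) = pscalar Q c *: (x *: v).
Proof. by rewrite !scalerA pscalarC. Qed.

(** Modules carry only their structure over the path algebra, so [k] acts through [pscalar]. *)
Definition klinear (U V : lmodType A) (f : U -> V) : Prop :=
  forall c x y, f (pscalar Q c *: x + y) = pscalar Q c *: f x + f y.

Section KLinear.
Variables (U V : lmodType A) (f : U -> V) (hf : klinear f).

Lemma klinearD x y : f (x + y) = f x + f y.
Proof. by have := hf 1 x y; rewrite pscalar1 !scale1r. Qed.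

Lemma klinear0 : f 0 = 0.
Proof. by apply: (addrI (f 0)); rewrite -klinearD !addr0. Qed.

Lemma klinearZ c x : f (pscalar Q c *: x) = pscalar Q c *: f x.
Proof. by have := hf c x 0; rewrite klinear0 !addr0. Qed.

Lemma klinearN x : f (- x) = - f x.
Proof. by apply: (addrI (f x)); rewrite -klinearD !subrr klinear0. Qed.

Lemma klinearB x y : f (x - y) = f x - f y.
Proof. by rewrite klinearD klinearN. Qed.

Lemma klinear_sum (I : Type) (r : seq I) (F : I -> U) :
  f (\sum_(i <- r) F i) = \sum_(i <- r) f (F i).
Proof. by elim/big_rec2: _ => [|i x y _ <-]; [apply: klinear0|rewrite klinearD]. Qed.

Lemma klinear_linear : (forall v x, f (vtx v *: x) = vtx v *: f x) ->
  (forall a x, f (arr a *: x) = arr a *: f x) -> linear f.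
Proof.
move=> fv fa.
suff fA a : forall x, f (a *: x) = a *: f x by move=> a x y; rewrite klinearD fA.
elim/pathalg_gen: a => // [x|a b ha hb x|c a ha x|a b ha hb x].
- by rewrite !scale0r klinear0.
- by rewrite !scalerDl klinearD ha hb.
- by rewrite pscalarZ (pscalarZ c a (f x)) klinearZ ha.
- by rewrite -!scalerA ha hb.
Qed.

End KLinear.

Lemma linear_klinear (U V : lmodType A) (f : {linear U -> V}) : klinear f.
Proof. by move=> c x y; rewrite linearP. Qed.

Lemma klinear_comp (U V W : lmodType A) (g : V -> W) (f : U -> V) :
  klinear g -> klinear f -> klinear (g \o f).
Proof. by move=> hg hf c x y /=; rewrite hf hg. Qed.

Lemma scale_klinear (U : lmodType A) (a : A) : klinear (fun x : U => a *: x).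
Proof. by move=> c x y; rewrite scalerDr pscalar_comm. Qed.

(** Zorn's lemma gives a maximal [k]-subspace meeting the kernel of [p] in zero; by maximality [p]
    maps it onto [V], and the section is the inverse. *)
Lemma klinear_section (U V : lmodType A) (p : {linear U -> V}) :
  Defs.surjective p -> exists s : V -> U, klinear s /\ forall y, p (s y) = y.
Proof.
move=> ps.
pose P (G : set U) := (forall c x y, G x -> G y -> G (pscalar Q c *: x + y)) /\
  (forall x, G x -> p x = 0 -> x = 0).
have [F FP totF|G [[Gl Gi] maxG]] := @Zorn_bigcup U P.
  split=> [c x y [X FX Xx] [Y FY Yy]|x [X FX Xx]]; last by have [_] := FP X FX; apply.
  have [XY|YX] := totF X Y FX FY.
    by exists Y => //; have [h _] := FP Y FY; apply: h => //; apply: XY.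
  by exists X => //; have [h _] := FP X FX; apply: h => //; apply: YX.
(* The empty set satisfies [P], as the union of an empty chain must; zero is therefore adjoined
   afterwards. *)
pose H x := x = 0 \/ G x.
have Hl c x y : H x -> H y -> H (pscalar Q c *: x + y).
  move=> [->|Gx] [->|Gy]; rewrite ?scaler0 ?addr0 ?add0r; [by left|by right| |].
    (* Closure of [G] concerns two members, so a multiple of [x] is written as a combination of [x]
       with itself. *)
    have -> : pscalar Q c *: x = pscalar Q (c - 1) *: x + x.
      by rewrite -[X in _ + X]scale1r -scalerDl -[X in _ + X](@pscalar1 k Q) -pscalarD subrK.
    by right; apply: Gl.
  by right; apply: Gl.
have Hi x : H x -> p x = 0 -> x = 0 by move=> [->|/Gi].
have hs y : exists x, H x /\ p x = y.
  apply: contrapT => ny; have [x0 px0] := ps y.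
  (* If [y] is not reached, the line through a preimage [x0] can be added: a kernel element with
     non-zero coefficient at [x0] would express [y] through [H]. *)
  pose G' x := exists c h, H h /\ x = pscalar Q c *: x0 + h.
  have H0 : H 0 by left.
  have Hz c h : H h -> H (pscalar Q c *: h) by move=> Hh; rewrite -[_ *: _]addr0; apply: Hl.
  apply: (maxG G').
    split; first by move=> x Gx; exists 0, x; rewrite /pscalar !scale0r add0r; split=> //; right.
    move=> /(_ x0) h; apply: ny; exists x0; split=> //; right; apply: h.
    by exists 1, 0; rewrite pscalar1 scale1r addr0.
  split=> [c x x' [d [h [Hh ->]]] [d' [h' [Hh' ->]]]|x [c [h [Hh ->]]]].
    exists (c * d + d'), (pscalar Q c *: h + h'); split; first exact: Hl.
    by rewrite scalerDr addrACA scalerA -pscalarM -scalerDl -pscalarD.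
  rewrite linearD linearZ /= px0 => e.
  have [c0|c0] := eqVneq c 0.
    by move: e; rewrite c0 /pscalar !scale0r !add0r; apply: Hi.
  case: ny; exists (pscalar Q (- c^-1) *: h); split; first exact: Hz.
  rewrite linearZ /=; have -> : p h = pscalar Q (- c) *: y.
    by move/eqP: e; rewrite addrC addr_eq0 => /eqP ->; rewrite /pscalar !scaleNr.
  by rewrite scalerA -pscalarM mulrNN mulVf // pscalar1 scale1r.
have [s hs'] := choice hs; exists s; split=> [c x y|y]; last by case: (hs' y).
apply/eqP; rewrite -subr_eq0; apply/eqP/Hi.
  have [h1 _] := hs' x; have [h2 _] := hs' y; have [h3 _] := hs' (pscalar Q c *: x + y).
  have := Hl (-1) _ _ (Hl c _ _ h1 h2) h3.
  by rewrite {1}/pscalar scaleN1r scaleN1r addrC.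
rewrite linearB linearD linearZ /=.
by case: (hs' x) (hs' y) (hs' (pscalar Q c *: x + y)) => _ -> [_ ->] [_ ->]; rewrite subrr.
Qed.

Lemma sum_supp (N : zmodType) (x : A) (s t : seq (qpath Q)) (F : qpath Q -> N) :
  uniq s -> uniq t -> (forall p, x p != 0 -> p \in s) -> (forall p, x p != 0 -> p \in t) ->
  (forall p, x p = 0 -> F p = 0) -> \sum_(p <- s) F p = \sum_(p <- t) F p.
Proof.
move=> us ut hs ht F0.
have h r : \sum_(p <- r) F p = \sum_(p <- [seq p <- r | x p != 0]) F p.
  rewrite big_filter [RHS]big_mkcond; apply: eq_bigr => p _.
  by case: eqP => // /F0.
rewrite h [RHS]h; apply: perm_big; apply: uniq_perm; rewrite ?filter_uniq // => p.
by rewrite !mem_filter; case: eqP => //= /eqP xp; rewrite hs // ht.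
Qed.

(** The map is a sum over a chosen list containing the support; additivity is checked by passing to
    a list common to both arguments. *)
Lemma path_basis (N : lmodType A) (phi : qpath Q -> N) :
  exists L : A -> N, [/\ forall x y, L (x + y) = L x + L y,
    forall c x, L (c *: x) = pscalar Q c *: L x & forall p, L (path_elt p) = phi p].
Proof.
have [s hs] := choice supp_exists.
pose L (x : A) := \sum_(p <- s x) pscalar Q (x p : k) *: phi p.
have LE (x : A) (t : seq (qpath Q)) : uniq t -> (forall p, x p != 0 -> p \in t) ->
    L x = \sum_(p <- t) pscalar Q (x p : k) *: phi p.
  move=> ut ht; have [us hsx] := hs x; apply: (sum_supp us ut hsx ht) => p ->.
  by rewrite /pscalar scale0r scale0r.
exists L; split=> [x y|c x|p].
- have [_ hx] := hs x; have [_ hy] := hs y.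
  pose t := undup (s x ++ s y).
  have ut : uniq t by apply: undup_uniq.
  have tx p : x p != 0 -> p \in t by move=> /hx h; rewrite mem_undup mem_cat h.
  have ty p : y p != 0 -> p \in t by move=> /hy h; rewrite mem_undup mem_cat h orbT.
  rewrite (LE x t) // (LE y t) // (LE _ t) // => [|p].
    by rewrite -big_split; apply: eq_bigr => p _; rewrite Defs.coefD pscalarD scalerDl.
  have [xp|/tx //] := eqVneq (x p) 0; have [yp|/ty //] := eqVneq (y p) 0.
  by rewrite Defs.coefD xp yp addr0 eqxx.
- have [us hx] := hs x; rewrite (LE _ (s x)) // => [|p].
    by rewrite scaler_sumr; apply: eq_bigr => p _; rewrite Defs.coefZ pscalarM scalerA.
  by rewrite Defs.coefZ mulf_eq0 negb_or => /andP [_ /hx].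
- rewrite (LE _ [:: p]) // => [|q]; last by rewrite path_eltE inE; apply: contraR => /negPf ->; rewrite mulr0n.
  by rewrite big_seq1 path_eltE eqxx pscalar1 scale1r.
Qed.

End Paths.

(** * Path algebras are hereditary *)

Section Hereditary.
Variables (k : fieldType) (Q : quiver).
Local Notation A := (pathalg k Q).
Local Notation vtx := (@vtx k Q).
Local Notation arr := (@arr k Q).

Section Integration.
Variables (M N : lmodType A) (theta : arrow Q -> M -> N).
Hypothesis theta_lin : forall a, klinear (theta a).
Hypothesis theta_head : forall a m, vtx (Defs.head a) *: theta a m = theta a m.
Hypothesis theta_tail : forall a m, theta a (vtx (tail a) *: m) = theta a m.

(** The list is reversed: its head is the last arrow traversed, the leftmost factor of the
    product. *)
Fixpoint mon_rev (v : vertex Q) (s : seq (arrow Q)) : A :=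
  if s is a :: s' then arr a * mon_rev v s' else vtx v.

(** The Leibniz rule for an arrow times a path, unrolled from the value 0 on vertices. *)
Fixpoint int_rev (v : vertex Q) (s : seq (arrow Q)) (m : M) : N :=
  if s is a :: s' then theta a (mon_rev v s' *: m) + arr a *: int_rev v s' m else 0.

Definition int_path (m : M) (p : qpath Q) : N := int_rev (val p).1 (rev (val p).2) m.

Lemma mon_rev_path (p : qpath Q) :
  mon_rev (val p).1 (rev (val p).2) = path_elt k p.
Proof.
elim/path_ind: p => // p q a IH e vq.
by rewrite vq /= rev_rcons /= IH (arr_path k e vq).
Qed.

Lemma int_path_rcons m (p q : qpath Q) a : val q = ((val p).1, rcons (val p).2 a) ->
  int_path m q = theta a (path_elt k p *: m) + arr a *: int_path m p.
Proof. by move=> vq; rewrite /int_path vq /= rev_rcons /= mon_rev_path. Qed.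

Lemma int_path_end m (p : qpath Q) : vtx (path_end p) *: int_path m p = int_path m p.
Proof.
elim/path_ind: p => [v|p q a IH e vq]; first by rewrite scaler0.
rewrite (int_path_rcons _ vq) /path_end vq /= /endpoint map_rcons last_rcons.
by rewrite scalerDr theta_head scalerA vtx_arr.
Qed.

(* Every cocycle [theta] given on the arrows extends to a crossed
   homomorphism, because the path algebra is freely generated by the arrows
   over its vertices. *)
Lemma integrate : exists D : A -> M -> N, [/\
  forall x y m, D (x + y) m = D x m + D y m,
  forall c x m, D (c *: x) m = pscalar Q c *: D x m,
  forall v x m, D (vtx v * x) m = vtx v *: D x m &
  forall a x m, D (arr a * x) m = theta a (x *: m) + arr a *: D x m].
Proof.
have [D' hD'] := choice (fun m => path_basis (int_path m)).
pose D x m := D' m x.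
have DD x y m : D (x + y) m = D x m + D y m by case: (hD' m) => h _ _; apply: h.
have DZ c x m : D (c *: x) m = pscalar Q c *: D x m by case: (hD' m) => _ h _; apply: h.
have Dp m p : D (path_elt k p) m = int_path m p by case: (hD' m) => _ _ h; apply: h.
have D0 m : D 0 m = 0 by have := DZ 0 0 m; rewrite scale0r /pscalar !scale0r.
have vD v p m : v != path_end p -> vtx v *: int_path m p = 0.
  by move=> h; rewrite -int_path_end scalerA vtx_orth // scale0r.
exists D; split=> // [v x m|a x m]; elim/pathalg_ind: x => [|x y hx hy|c x hx|p].
- by rewrite mulr0 D0 scaler0.
- by rewrite mulrDr !DD hx hy scalerDr.
- by rewrite -pathalg_scaleAr !DZ hx pscalar_comm.
- have [->|ne] := eqVneq v (path_end p); first by rewrite vtx_path Dp int_path_end.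
  by rewrite vtx_path0 1?eq_sym // D0 Dp vD.
- by rewrite mulr0 D0 scaler0 scale0r addr0 (klinear0 (theta_lin a)).
- rewrite mulrDr !DD hx hy scalerDl scalerDr (klinearD (theta_lin a)).
  by rewrite addrACA.
- rewrite -pathalg_scaleAr !DZ hx (pscalarZ c x m) (klinearZ (theta_lin a)) pscalar_comm.
  by rewrite scalerDr.
- have [e|ne] := eqVneq (tail a) (path_end p).
    have w : walk (val p).1 (rcons (val p).2 a).
      rewrite -cats1 walk_cat (valP p) /= andbT e.
      exact: eqxx.
    pose q : qpath Q := exist _ ((val p).1, rcons (val p).2 a) w.
    by rewrite (arr_path k (esym e) (erefl : val q = _)) !Dp (int_path_rcons _ (erefl : val q = _)).
  (* If the path does not end at the tail of [a], all three terms vanish: the product is zero,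
     [theta a] sees only the component at the tail, and [arr a] kills values at other vertices. *)
  rewrite mul_path0 1?eq_sym // D0 Dp -theta_tail !scalerA.
  rewrite vtx_path0 1?eq_sym // scale0r (klinear0 (theta_lin a)) add0r.
  by rewrite -arr_vtx -scalerA vD // scaler0.
Qed.

End Integration.

Definition projective (P : lmodType A) : Prop :=
  forall (U V : lmodType A) (p : {linear U -> V}) (f : {linear P -> V}),
    Defs.surjective p -> exists g : {linear P -> U}, forall x, p (g x) = f x.

Lemma row_expand n (c : 'rV[A]_n) : c = \sum_i c 0 i *: delta_mx 0 i.
Proof.
apply/rowP => j; rewrite summxE (bigD1 j) //= !mxE !eqxx mulr1 big1 ?addr0 // => i ij.
by rewrite !mxE eqxx eq_sym (negPf ij) mulr0.
Qed.

Lemma row_linear n (M : lmodType A) (m : 'I_n -> M) :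
  exists f : {linear 'rV[A]_n -> M}, forall c, f c = \sum_i c 0 i *: m i.
Proof.
have lin : linear (fun c : 'rV[A]_n => \sum_i c 0 i *: m i).
  move=> a c d; rewrite scaler_sumr -big_split /=.
  by apply: eq_bigr => i _; rewrite !mxE scalerDl scalerA.
by exists (make_linear lin).
Qed.

Lemma row_projective n : projective 'rV[A]_n.
Proof.
move=> U V p f ps.
have [u pu] := choice (fun i => ps (f (delta_mx 0 i))).
have [g gE] := row_linear u; exists g => c.
rewrite gE {2}[c]row_expand !linear_sum.
by apply: eq_bigr => i _; rewrite !linearZ /= pu.
Qed.

(** A [k]-linear section [s] of [p] gives the retraction [x - s (p x)]. *)
Lemma klinear_retraction (K P M : lmodType A) (i : {linear K -> P})
    (p : {linear P -> M}) : short_exact i p ->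
  exists r : P -> K, klinear r /\ forall x, r (i x) = x.
Proof.
move=> [[ii ki] ps]; have [s [sl sP]] := klinear_section ps.
have h x : exists y, i y = x - s (p x).
  by apply/ki; rewrite linearB /= sP subrr.
have [r hr] := choice h; exists r; split=> [c x y|x]; apply: ii.
  rewrite linearP !hr linearP sl scalerBr opprD addrACA //.
by rewrite hr (ki (i x)).2 ?(klinear0 sl) ?subr0 //; exists x.
Qed.

(** Keep only the blocks of [g0] that map a vertex component to the component at the same vertex. *)
Lemma vtx_klinear (U V : lmodType A) (g0 : U -> V) : klinear g0 ->
  exists g : U -> V, [/\ klinear g, forall v x, g (vtx v *: x) = vtx v *: g x &
    forall x, (forall a, g0 (a *: x) = a *: g0 x) -> g x = g0 x].
Proof.
move=> hg; exists (fun x => \sum_v vtx v *: g0 (vtx v *: x)); split=> [c x y|w x|x hx].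
- rewrite scaler_sumr -big_split; apply: eq_bigr => v _ /=.
  by rewrite scalerDr pscalar_comm hg scalerDr pscalar_comm.
- rewrite scaler_sumr; apply: eq_bigr => v _; rewrite !scalerA.
  have [<-|vw] := eqVneq v w; first by rewrite vtx_idem.
  have wv : w != v by rewrite eq_sym.
  by rewrite (vtx_orth _ vw) (vtx_orth _ wv) !scale0r (klinear0 hg) scaler0.
- under eq_bigr do rewrite hx scalerA vtx_idem.
  by rewrite -scaler_suml sum_vtx scale1r.
Qed.

(* Given [f : K -> V], its defect from extending to [P] is a cocycle on
   [M = P/K]; lift the cocycle along [p], and integrate it on [P]. *)
Theorem hereditary n (K M : lmodType A) (i : {linear K -> 'rV[A]_n})
    (q : {linear 'rV[A]_n -> M}) : short_exact i q -> projective K.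
Proof.
move=> iq U V p f ps.
have [r [rl ri]] := klinear_retraction iq.
have [[ii ki] qs] := iq.
have [sq [sql sqP]] := klinear_section qs.
have [sp [spl spP]] := klinear_section ps.
have [g [gl gv gE]] := vtx_klinear (klinear_comp (linear_klinear f) rl).
have {}gE x : g (i x) = f x.
  rewrite gE /= ?ri // => a.
  by have := ri (a *: x); rewrite linearZ /= => ->; rewrite ?ri ?linearZ.
(* The defect of [g] at the arrow [a]. It vanishes on the image of [K], where [g] is [f], so it
   depends only on [q x]. *)
pose theta0 a x := g (arr a *: x) - arr a *: g x.
have th0l a : klinear (theta0 a).
  move=> c x y; rewrite /theta0 !scalerDr pscalar_comm !gl !scalerDr pscalar_comm opprD.
  by rewrite addrACA scalerN.
have th0K a x y : q x = q y -> theta0 a x = theta0 a y.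
  move=> e; apply/eqP; rewrite -subr_eq0 -(klinearB (th0l a)).
  have /ki [z <-] : q (x - y) = 0 by rewrite linearB /= e subrr.
  by rewrite /theta0 -linearZ /= !gE linearZ subrr.
(* The sections [sq] and [sp] turn the defect into maps from [M] to [U]; the vertex factors place
   them at the tail and head, as integration requires. *)
pose theta a m := vtx (Defs.head a) *: sp (theta0 a (vtx (tail a) *: sq m)).
have thl a : klinear (theta a).
  apply: (klinear_comp (scale_klinear _)); apply: (klinear_comp spl).
  by apply: (klinear_comp (th0l a)); apply: (klinear_comp (scale_klinear _)).
have thh a m : vtx (Defs.head a) *: theta a m = theta a m.
  by rewrite /theta scalerA vtx_idem.
have tht a m : theta a (vtx (tail a) *: m) = theta a m.
  congr (_ *: sp _); apply: th0K.
  by rewrite !linearZ /= !sqP scalerA vtx_idem.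
have pth a x : p (theta a (q x)) = theta0 a x.
  rewrite linearZ /= spP (th0K a _ (vtx (tail a) *: x)) ?linearZ /= ?sqP //.
  by rewrite /theta0 gv !scalerA arr_vtx scalerBr scalerA vtx_arr -gv scalerA vtx_arr.
have [D [DD DZ Dv Da]] := integrate thl thh tht.
(* Coordinatewise integration gives a map [T] to [U] whose defect at [a] is [theta a (q x)]. Since
   [q] vanishes on [K], [T] is linear there. *)
pose T (c : 'rV[A]_n) := \sum_j D (c 0 j) (q (delta_mx 0 j)).
have Tl : klinear T.
  move=> c x y; rewrite /T scaler_sumr -big_split; apply: eq_bigr => j _ /=.
  by rewrite !mxE DD -pathalg_scaleAl mul1r DZ.
have Tv v x : T (vtx v *: x) = vtx v *: T x.
  by rewrite scaler_sumr; apply: eq_bigr => j _; rewrite mxE Dv.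
have Ta a x : T (arr a *: x) = theta a (q x) + arr a *: T x.
  rewrite {2}[x]row_expand linear_sum (klinear_sum (thl a)) scaler_sumr -big_split.
  by apply: eq_bigr => j _ /=; rewrite mxE Da linearZ.
have G0l : linear (T \o i).
  apply: klinear_linear => [|v x|a x] /=.
  - exact: klinear_comp (linear_klinear i).
  - by rewrite linearZ /= Tv.
  - rewrite linearZ /= Ta (ki _).2 ?(klinear0 (thl a)) ?add0r //.
    by exists x.
(* [p (T x)] and [g x] have the same defect, so their difference is linear on the free module and
   lifts along [p] to [d]. On [K], subtracting [d] from [T] leaves a lift of [f]. *)
have dl : linear (fun x => p (T x) - g x).
  apply: klinear_linear => [c x y|v x|a x].
  - by rewrite Tl gl linearP opprD addrACA scalerBr.
  - by rewrite Tv gv linearZ scalerBr.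
  - by rewrite Ta linearD pth linearZ /theta0 scalerBr addrAC (addrAC (g _)) subrr add0r addrC.
have [d dP] := row_projective (make_linear dl) ps.
exists (make_linear G0l \- (d \o i)) => x /=.
by rewrite linearB /= dP /= /linear_fun /= opprB addrC subrK gE.
Qed.

End Hereditary.

(** * Long exact sequences as dimension inequalities *)

Section Dimensions.
Variables (k : fieldType) (Q : quiver).
Local Notation A := (pathalg k Q).
Implicit Types X Y K P L M N : lmodType A.

Definition extends K P (i : {linear K -> P}) N (f : {linear K -> N}) : Prop :=
  exists g : {linear P -> N}, forall x, f x = g (i x).

Definition hom_le n M N : Prop := cod n (fun f : {linear M -> N} => f = 0).

(* [Ext(M, N)] has dimension at most [n], when [i] is the kernel of a
   projective cover of [M]. *)
Definition pext_le n K P (i : {linear K -> P}) N : Prop := cod n (@extends K P i N).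

Lemma hom_eq0 M N (f : {linear M -> N}) : (forall x, f x = 0) -> f = 0.
Proof. by move=> h; apply: linearP_eq => x; rewrite h. Qed.

Lemma subspace_eq0 (V : lmodType k) : subspace (fun v : V => v = 0).
Proof. by split=> // a u v -> ->; rewrite scaler0 addr0. Qed.

Lemma subspace_extends K P (i : {linear K -> P}) N : subspace (@extends K P i N).
Proof.
split=> [|a f g [f' hf] [g' hg]]; first by exists 0.
by exists (a *: f' + g') => x; rewrite !lin_addE !lin_scaleE hf hg.
Qed.

Definition pre_rel X M N (a : {linear X -> M}) (f : {linear M -> N})
  (g : {linear X -> N}) : Prop := forall x, g x = f (a x).

Definition post_rel X M N (b : {linear M -> N}) (f : {linear X -> M})
  (g : {linear X -> N}) : Prop := forall x, g x = b (f x).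

Lemma pre_rel_linear X M N (a : {linear X -> M}) : linear_rel (@pre_rel X M N a).
Proof.
split=> // [c v v' w w' h h' x|f]; first by rewrite !lin_addE !lin_scaleE h h'.
by exists ((f : {linear M -> N}) \o a : {linear X -> N}).
Qed.

Lemma post_rel_linear X M N (b : {linear M -> N}) : linear_rel (@post_rel X M N b).
Proof.
split=> [x|c v v' w w' h h' x|f]; first by rewrite !lin_zeroE linear0.
  by rewrite !lin_addE !lin_scaleE h h' linearP.
by exists (b \o (f : {linear X -> M}) : {linear X -> N}).
Qed.

Hint Resolve subspace_eq0 subspace_extends pre_rel_linear
  post_rel_linear : core.

(** Comparison maps [a] and [b] of the covers lift the identity of [M]. As [x - b (a x)] lies in
    [K'], going to [K] and back is the identity modulo maps extending to [P']. *)
Lemma pext_indep n M N K P (i : {linear K -> P}) (p : {linear P -> M})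
    K' P' (i' : {linear K' -> P'}) (p' : {linear P' -> M}) :
  short_exact i p -> projective P -> short_exact i' p' -> projective P' ->
  pext_le n i N -> pext_le n i' N.
Proof.
move=> [[ii ki] ps] Pp [[ii' ki'] ps'] Pp'.
have [a ha] := Pp' _ _ p p' ps; have [b hb] := Pp _ _ p' p ps'.
have [aK haK] : exists aK : {linear K' -> K}, forall x, i (aK x) = a (i' x).
  by apply: (factor_inj (f := a \o i')) => // x; apply/ki; rewrite /= ha; apply/ki'; exists x.
have [bK hbK] : exists bK : {linear K -> K'}, forall x, i' (bK x) = b (i x).
  by apply: (factor_inj (f := b \o i)) => // x; apply/ki'; rewrite /= hb; apply/ki; exists x.
apply: (cod_exact0r (F := pre_rel aK)) => // [f g fg [e he]|v].
  by exists (e \o a) => x; rewrite fg he haK.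
pose w : {linear K -> N} := (v : {linear K' -> N}) \o bK.
exists w, (w \o aK : {linear K' -> N}); split=> //.
have [c hc] : exists c : {linear P' -> K'}, forall x, i' (c x) = x - b (a x).
  apply: (factor_inj (f := idfun \- (b \o a))) => // x; apply/ki'.
  by rewrite /= linearB /= hb ha subrr.
exists ((v : {linear K' -> N}) \o c) => x; rewrite lin_addE lin_oppE /=.
suff -> : c (i' x) = x - bK (aK x) by rewrite linearB.
by apply: ii'; rewrite hc linearB hbK haK.
Qed.

(** * The long exact sequence in the second variable *)

Section Covariant.
Variables (K P X L M N : lmodType A) (i : {linear K -> P}) (p : {linear P -> X})
  (j : {linear L -> M}) (q : {linear M -> N}).
Hypotheses (ip : short_exact i p) (Pp : projective P) (Kp : projective K)
  (jq : short_exact j q).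

Lemma lift_sub Y (f : {linear Y -> M}) : (forall x, q (f x) = 0) ->
  exists g : {linear Y -> L}, forall x, j (g x) = f x.
Proof. by case: jq => [[ji kj] _] h; apply: factor_inj => // x; apply/kj. Qed.

Lemma qj0 x : q (j x) = 0.
Proof. by case: jq => [[_ kj] _]; apply/kj; exists x. Qed.

(** The connecting map from [Hom(X, N)] to [Ext(X, L)]; the lift [h] to the projective cover is a
    choice. *)
Definition conn_rel (f : {linear X -> N}) (g : {linear K -> L}) : Prop :=
  exists h : {linear P -> M}, (forall x, q (h x) = f (p x)) /\
    forall x, j (g x) = h (i x).

Lemma conn_rel_linear : linear_rel conn_rel.
Proof.
split=> [|c f f' g g' [h [h1 h2]] [h' [h1' h2']]|f].
- by exists 0; split=> x; rewrite !lin_zeroE ?linear0.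
- exists (c *: h + h'); split=> x.
    by rewrite !lin_addE !lin_scaleE linearP h1 h1'.
  by rewrite !lin_addE !lin_scaleE linearP h2 h2'.
have [h hh] := Pp (p := q) ((f : {linear X -> N}) \o p) jq.2.
have [|g hg] := @lift_sub _ (h \o i).
  by move=> x; rewrite /= hh /= (ip.1.2 (i x)).2 ?linear0 //; exists x.
by exists g, h.
Qed.

Hint Resolve conn_rel_linear : core.

(** This and the next five bounds express exactness at the successive terms of [0 -> Hom(X, L) ->
    Hom(X, M) -> Hom(X, N) -> Ext(X, L) -> Ext(X, M) -> Ext(X, N) -> 0]. *)
Lemma cov_hom_ker n : hom_le n X M -> hom_le n X L.
Proof.
apply: (cod_exact0l (G := post_rel j)) => // f g fg g0; apply: hom_eq0 => x.
by apply: jq.1.1; rewrite -fg g0 lin_zeroE linear0.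
Qed.

Lemma cov_hom_ext n m : hom_le n X L -> hom_le m X N -> hom_le (n + m) X M.
Proof.
apply: (cod_exact (F := post_rel j) (G := post_rel q)) => // [f g fg f0|f g fg g0].
  by apply: hom_eq0 => x; rewrite fg f0 lin_zeroE linear0.
have [|e he] := @lift_sub _ f; first by move=> x; rewrite -fg g0.
by exists e, f; rewrite subrr; split=> // x; rewrite he.
Qed.

Lemma cov_hom_coker n m : hom_le n X M -> pext_le m i L -> hom_le (n + m) X N.
Proof.
apply: (cod_exact (F := post_rel q) (G := conn_rel)) => // [f g fg f0|f g [h [h1 h2]] [e he]].
  by apply: hom_eq0 => x; rewrite fg f0 lin_zeroE linear0.
(* [h] and [j \o e] agree on [K], so their difference descends to a map from [X] to [M] lifting
   [f]. *)
have [|d hd] := factor_surj (p := p) (f := h \- (j \o e)) ip.2.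
  by move=> x /ip.1.2 [y <-]; rewrite /= -h2 he subrr.
exists d, f; rewrite subrr; split=> // x; have [y <-] := ip.2 x.
by rewrite hd /= linearB /= qj0 subr0 h1.
Qed.

Lemma cov_ext_ker n m : hom_le n X N -> pext_le m i M -> pext_le (n + m) i L.
Proof.
apply: (cod_exact (F := conn_rel) (G := post_rel j)) => // [f g [h [h1 h2]] f0|f g fg [e he]].
  have [|d hd] := @lift_sub _ h; first by move=> x; rewrite h1 f0.
  by exists d => x; apply: jq.1.1; rewrite hd h2.
have [|d hd] := factor_surj (p := p) (f := q \o e) ip.2.
  by move=> x /ip.1.2 [y <-]; rewrite /= -he fg qj0.
exists d, f; rewrite subrr; split; last by case: (subspace_extends i L).
by exists e; split=> x; rewrite ?hd // -he fg.
Qed.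

Lemma cov_ext_ext n m : pext_le n i L -> pext_le m i N -> pext_le (n + m) i M.
Proof.
apply: (cod_exact (F := post_rel j) (G := post_rel q)) => // [f g fg [e he]|f g fg [e he]].
  by exists (j \o e) => x; rewrite fg he.
have [d hd] := Pp (p := q) e jq.2.
have [|c hc] := @lift_sub _ (f \- (d \o i)).
  by move=> x; rewrite /= linearB /= hd -he fg subrr.
exists c, (j \o c : {linear K -> M}); split=> //; exists d => x.
by rewrite lin_addE lin_oppE /= hc /= opprB addrC subrK.
Qed.

(** Right exactness of Ext: the syzygy [K] is projective, so maps from [K] to [N] lift to [M]. *)
Lemma cov_ext_coker n : pext_le n i M -> pext_le n i N.
Proof.
apply: (cod_exact0r (F := post_rel q)) => // [f g fg [e he]|g].
  by exists (q \o e) => x; rewrite fg he.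
have [f hf] := Kp (p := q) g jq.2; exists f, g; rewrite subrr; split=> //.
by case: (subspace_extends i N).
Qed.

End Covariant.

(** * The long exact sequence in the first variable *)

Section Contravariant.
Variables (K P X L M N : lmodType A) (j : {linear L -> M}) (q : {linear M -> N}).
Hypothesis jq : short_exact j q.

Lemma con_hom_coker n : hom_le n M X -> hom_le n N X.
Proof.
apply: (cod_exact0l (G := pre_rel q)) => // f g fg g0; apply: hom_eq0 => x.
by have [y <-] := jq.2 x; rewrite -fg g0.
Qed.

Lemma con_hom_ext n m : hom_le n N X -> hom_le m L X -> hom_le (n + m) M X.
Proof.
apply: (cod_exact (F := pre_rel q) (G := pre_rel j)) => // [f g fg f0|f g fg g0].
  by apply: hom_eq0 => x; rewrite fg f0.
have [|e he] := factor_surj (p := q) (f := f) jq.2.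
  by move=> x /jq.1.2 [y <-]; rewrite -fg g0.
by exists e, f; rewrite subrr; split=> // x; rewrite he.
Qed.

(* [K0 < K1 < P] with [P/K0 = M], [P/K1 = N] and [K1/K0 = L]. *)
Variables (K0 K1 : lmodType A) (i0 : {linear K0 -> P}) (i1 : {linear K1 -> P})
  (i01 : {linear K0 -> K1}) (p : {linear P -> M}) (r : {linear K1 -> L}).
Hypotheses (ip : short_exact i0 p) (ir : short_exact i01 r)
  (iqp : short_exact i1 (q \o p)) (i0E : forall x, i0 x = i1 (i01 x))
  (rE : forall x, j (r x) = p (i1 x)).

Lemma con_hom_ker n m : hom_le n M X -> pext_le m i1 X -> hom_le (n + m) L X.
Proof.
apply: (cod_exact (F := pre_rel j) (G := pre_rel r)) => // [f g fg f0|f g fg [e he]].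
  by apply: hom_eq0 => x; rewrite fg f0.
have [|d hd] := factor_surj (p := p) (f := e) ip.2.
  move=> x /ip.1.2 [y <-]; rewrite i0E -he fg (ir.1.2 _).2 ?linear0 //; by exists y.
exists d, f; rewrite subrr; split=> // x; have [y <-] := ir.2 x.
by rewrite -fg rE hd he.
Qed.

Lemma con_ext_coker n m : hom_le n L X -> pext_le m i0 X -> pext_le (n + m) i1 X.
Proof.
apply: (cod_exact (F := pre_rel r) (G := pre_rel i01)) => // [f g fg f0|f g fg [e he]].
  by exists 0 => x; rewrite fg f0.
have [|d hd] := factor_surj (p := r) (f := f \- (e \o i1)) ir.2.
  by move=> x /ir.1.2 [y <-]; rewrite /= -fg -i0E he subrr.
exists d, (d \o r : {linear K1 -> X}); split=> //; exists e => x.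
by rewrite lin_addE lin_oppE /= hd /= opprB addrC subrK.
Qed.

(** When [K1] is projective, [i01] resolves [L]. The map to [Ext(L, X)] is then the identity on maps
    out of [K0], which explains the relation [eq]. *)
Lemma con_ext_ext n m : pext_le n i1 X -> pext_le m i01 X -> pext_le (n + m) i0 X.
Proof.
apply: (cod_exact (F := pre_rel i01) (G := eq)) => //.
- by split=> // [a v v' w w' -> ->|f] //; exists f.
- by move=> f g fg [e he]; exists e => x; rewrite fg he i0E.
move=> f _ <- [e he]; exists e, f; rewrite subrr; split=> //.
by case: (subspace_extends i0 X).
Qed.

Lemma con_ext_ker n : pext_le n i0 X -> pext_le n i01 X.
Proof. by apply: cod_sub => f [g hg]; exists (g \o i1) => x; rewrite hg i0E. Qed.

End Contravariant.

End Dimensions.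

(** * Ext of finitely generated modules *)

Section FiniteGeneration.
Variables (k : fieldType) (Q : quiver).
Local Notation A := (pathalg k Q).
Implicit Types L M N : lmodType A.

Lemma fg_cover M : finitely_generated M <->
  exists n (f : {linear 'rV[A]_n -> M}), Defs.surjective f.
Proof.
split=> [[n [g hg]]|[n [f fs]]].
  have [f fE] := row_linear g; exists n, f => m.
  by have [c ->] := hg m; exists c; rewrite fE.
exists n, (fun i => f (delta_mx 0 i)) => m; have [c <-] := fs m.
by exists c; rewrite {1}[c]row_expand linear_sum; apply: eq_bigr => i _; rewrite linearZ.
Qed.

Lemma fg_quot M N (q : {linear M -> N}) : Defs.surjective q ->
  finitely_generated M -> finitely_generated N.
Proof.
move=> qs /fg_cover [n [f fs]]; apply/fg_cover; exists n, (q \o f) => y.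
by have [x <-] := qs y; have [c <-] := fs x; exists c.
Qed.

Lemma fg_ext L M N (j : {linear L -> M}) (q : {linear M -> N}) : short_exact j q ->
  finitely_generated L -> finitely_generated N -> finitely_generated M.
Proof.
move=> [[ji kj] qs] /fg_cover [n [f fs]] /fg_cover [m [g gs]].
have [h hh] := row_projective g qs.
have lin : linear (fun c : 'rV[A]_(n + m) => j (f (lsubmx c)) + h (rsubmx c)).
  move=> a c d; have -> : lsubmx (a *: c + d) = a *: lsubmx c + lsubmx d.
    by apply/matrixP => i i'; rewrite !mxE.
  have -> : rsubmx (a *: c + d) = a *: rsubmx c + rsubmx d.
    by apply/matrixP => i i'; rewrite !mxE.
  by rewrite !linearP scalerDr addrACA.
apply/fg_cover; exists (n + m)%N, (make_linear lin) => x.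
have [d hd] := gs (q x).
have [l hl] : exists l, j l = x - h d by apply/kj; rewrite linearB /= hh hd subrr.
have [c hc] := fs l; exists (row_mx c d).
by rewrite /= /linear_fun row_mxKl row_mxKr hc hl subrK.
Qed.

(** Maps out of [kQ] are the elements of [M], so a finite spanning set over [k] also generates [M]
    over [kQ]. *)
Lemma fg_findim n M : hom_le n 'rV[A]_1 M -> finitely_generated M.
Proof.
move=> [b hb]; exists n, (fun i => (b i : {linear _ -> _}) (delta_mx 0 0)) => m.
have [f fE] := @row_linear k Q 1 M (fun=> m).
have [c hc] := hb f; exists (\row_i pscalar Q (c i)).
have : f (delta_mx 0 0) = (\sum_i c i *: b i : {linear 'rV[A]_1 -> M}) (delta_mx 0 0).
  by rewrite -(subr0_eq hc).
rewrite fE big_ord1 mxE scale1r => ->.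
under [RHS]eq_bigr do rewrite mxE.
by elim/big_rec2: _ => // i x y _ <-.
Qed.

End FiniteGeneration.

Section ExtModules.
Variables (k : fieldType) (Q : quiver).
Local Notation A := (pathalg k Q).
Implicit Types L M N X Y : lmodType A.

Section Syzygy.
Variable M : fgmod k Q.

Lemma syz_val_linear : linear (@syz_val k Q M). Proof. by []. Qed.

Definition syz_incl : {linear syz M -> 'rV[A]_(ngens M)} := make_linear syz_val_linear.

Definition pres : {linear 'rV[A]_(ngens M) -> M} := @pres_fun k Q M.

Lemma syz_exact : short_exact syz_incl pres.
Proof.
split; last exact: pres_surj.
split=> [|x]; first exact: val_inj.
split=> [fx|[y <-]]; last exact/eqP/(syzP y).
have kx : syz_pred x by apply/eqP.
by exists (Syz kx).
Qed.

Lemma syz_projective : projective (syz M : lmodType A).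
Proof. exact: hereditary syz_exact. Qed.

Definition ext_le n N : Prop := pext_le n syz_incl N.

End Syzygy.

Lemma ext_leP n (M : fgmod k Q) N (K P : lmodType A) (i : {linear K -> P})
    (p : {linear P -> M}) : short_exact i p -> projective P ->
  pext_le n i N <-> ext_le M n N.
Proof.
move=> ip Pp; have h := syz_exact M; have h' := @row_projective k Q (ngens M).
by split; apply: pext_indep; eassumption.
Qed.

Section CovariantExt.
Variables (X : fgmod k Q) (L M N : lmodType A) (j : {linear L -> M}) (q : {linear M -> N}).
Hypothesis jq : short_exact j q.
Let ip := syz_exact X.
Let Pp := @row_projective k Q (ngens X).
Let Kp := @syz_projective X.

Lemma ext_le_sub n m : hom_le n X N -> ext_le X m M -> ext_le X (n + m) L.
Proof. exact: (cov_ext_ker ip Pp jq). Qed.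

Lemma hom_le_quot n m : hom_le n X M -> ext_le X m L -> hom_le (n + m) X N.
Proof. exact: (cov_hom_coker ip Pp jq). Qed.

Lemma ext_le_mid n m : ext_le X n L -> ext_le X m N -> ext_le X (n + m) M.
Proof. exact: (cov_ext_ext Pp jq). Qed.

Lemma ext_le_quot n : ext_le X n M -> ext_le X n N.
Proof. exact: (cov_ext_coker Kp jq). Qed.

Lemma ext0_lift (f : {linear X -> N}) : ext_le X 0 L ->
  exists g : {linear X -> M}, forall x, q (g x) = f x.
Proof.
have [_ _ /(_ f) [g [h [h1 h2]]]] := conn_rel_linear ip Pp jq.
move=> /cod0E -/(_ g) [e he].
have [|d hd] := factor_surj (p := pres X) (f := h \- (j \o e)) ip.2.
  by move=> x /ip.1.2 [y <-]; rewrite /= -h2 he subrr.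
exists d => x; have [y <-] := ip.2 x.
by rewrite hd /= linearB /= (qj0 jq) subr0 h1.
Qed.

(** Exactness at [Ext(X, L)] with zero connecting map: an extension [e] to the cover induces [d]
    from [X] to [N], and subtracting a lift of [d] brings [e] into [L]. *)
Lemma ext0_sub :
  (forall f : {linear X -> N}, exists g : {linear X -> M}, forall x, q (g x) = f x) ->
  ext_le X 0 M -> ext_le X 0 L.
Proof.
move=> lift e0; apply: cod0 => f.
have [e he] := cod0E (j \o (f : {linear _ -> _}) : {linear _ -> _}) e0.
have [|d hd] := factor_surj (p := pres X) (f := q \o e) ip.2.
  by move=> x /ip.1.2 [y <-]; rewrite /= -he /= (qj0 jq).
have [c hc] := lift d.
have [|b hb] := @lift_sub _ _ _ _ _ _ _ jq _ (e \- (c \o pres X)).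
  by move=> x; rewrite /= linearB /= hc hd subrr.
exists b => x; apply: jq.1.1; rewrite hb /= -he /=.
have -> : pres X (syz_incl X x) = 0 by apply/ip.1.2; exists x.
by rewrite linear0 subr0.
Qed.

End CovariantExt.

Section ContravariantExt.
Variables (L M N : fgmod k Q) (j : {linear L -> M}) (q : {linear M -> N}).
Hypothesis jq : short_exact j q.

(** [K1] is the kernel of the composite cover of [N]; it contains the syzygy of [M] with quotient
    [L]. Thus the cover of [M] also resolves [N], and [K1] covers [L]. *)
Lemma pres_filtration : exists (K1 : lmodType A) (i1 : {linear K1 -> 'rV[A]_(ngens M)})
    (i01 : {linear syz M -> K1}) (r : {linear K1 -> L}),
  [/\ short_exact i1 (q \o pres M), short_exact i01 r,
      forall x, syz_incl M x = i1 (i01 x) & forall x, j (r x) = pres M (i1 x)].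
Proof.
have ip := syz_exact M.
have [K1 [i1 h1]] := kernel_exists (q \o pres M).
have [i01 h01] : exists i01 : {linear syz M -> K1}, forall x, i1 (i01 x) = syz_incl M x.
  apply: factor_inj h1.1 _ => x; apply/h1.2; rewrite /= (ip.1.2 _).2 ?linear0 //.
  by exists x.
have [|r hr] := @lift_sub _ _ _ _ _ _ _ jq _ (pres M \o i1).
  by move=> x; apply/h1.2; exists x.
exists K1, i1, i01, r; split=> //; split=> //.
- by move=> y; have [x <-] := jq.2 y; have [c <-] := ip.2 x; exists c.
- split=> [x y e|x]; first by apply: ip.1.1; rewrite -!h01 e.
  split=> [rx0|[y <-]]; last first.
    by apply: jq.1.1; rewrite hr linear0 /= h01; apply/ip.1.2; exists y.
  have /ip.1.2 [y hy] : pres M (i1 x) = 0 by rewrite -[LHS]hr rx0 linear0.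
  by exists y; apply: h1.1; rewrite h01.
- move=> y; have [c hc] := ip.2 (j y).
  have /h1.2 [x hx] : (q \o pres M) c = 0 by rewrite /= hc (qj0 jq).
  by exists x; apply: jq.1.1; rewrite hr /= hx hc.
Qed.

Variable X : lmodType A.

Lemma hom_le_sub n m : hom_le n M X -> ext_le N m X -> hom_le (n + m) L X.
Proof.
have [K1 [i1 [i01 [r [h1 h01 e1 e2]]]]] := pres_filtration.
move=> h /(ext_leP _ _ h1 (@row_projective _ _ _)) h'.
exact: (con_hom_ker (syz_exact M) h01 e1 e2 h h').
Qed.

Lemma ext_le_conquot n m : hom_le n L X -> ext_le M m X -> ext_le N (n + m) X.
Proof.
have [K1 [i1 [i01 [r [h1 h01 e1 e2]]]]] := pres_filtration.
move=> h h'; apply/(ext_leP _ _ h1 (@row_projective _ _ _)).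
exact: (con_ext_coker h01 e1 h h').
Qed.

Lemma ext_le_conmid n m : ext_le N n X -> ext_le L m X -> ext_le M (n + m) X.
Proof.
have [K1 [i1 [i01 [r [h1 h01 e1 e2]]]]] := pres_filtration.
move=> /(ext_leP _ _ h1 (@row_projective _ _ _)) h.
move=> /(ext_leP _ _ h01 (hereditary h1)) h'.
exact: (con_ext_ext e1 h h').
Qed.

Lemma ext_le_consub n : ext_le M n X -> ext_le L n X.
Proof.
have [K1 [i1 [i01 [r [h1 h01 e1 e2]]]]] := pres_filtration.
move=> h; apply/(ext_leP _ _ h01 (hereditary h1)).
exact: (con_ext_ker e1 h).
Qed.

End ContravariantExt.

(** [M] is the quotient of the sum of a free cover of [N] and [L] by a copy of the syzygy of [N].
    Vanishing of Ext provides the map [e] on the cover for which [e] and [f] together kill that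
    copy. *)
Lemma ext0_extend (N : fgmod k Q) L M X (j : {linear L -> M}) (q : {linear M -> N})
    (f : {linear L -> X}) : short_exact j q -> ext_le N 0 X ->
  exists g : {linear M -> X}, forall x, g (j x) = f x.
Proof.
move=> jq e0; have ip := syz_exact N; have Pp := @row_projective k Q (ngens N).
have [a ha] := Pp _ _ q (pres N) jq.2.
have [|aK haK] := @lift_sub _ _ _ _ _ _ _ jq _ (a \o syz_incl N).
  by move=> x; rewrite /= ha; apply/ip.1.2; exists x.
have [e he] := cod0E (f \o aK : {linear _ -> _}) e0.
have l1 : linear (fun z : 'rV[A]_(ngens N) * L => a z.1 + j z.2).
  by move=> c x y /=; rewrite !linearP scalerDr addrACA.
have l2 : linear (fun z : 'rV[A]_(ngens N) * L => e z.1 + f z.2).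
  by move=> c x y /=; rewrite !linearP scalerDr addrACA.
have [|[x l] /= h|g hg] := factor_surj (p := make_linear l1) (f := make_linear l2).
- move=> m; have [x hx] := ip.2 (q m).
  have /jq.1.2 [l hl] : q (m - a x) = 0 by rewrite linearB /= ha hx subrr.
  by exists (x, l); rewrite /= /linear_fun /= hl addrC subrK.
- move: h; rewrite /linear_fun /= => h.
  have /ip.1.2 [s hs] : pres N x = 0.
    by rewrite -ha -[RHS](linear0 q) -h linearD /= (qj0 jq) addr0.
  have -> : l = - aK s.
    by apply: jq.1.1; rewrite linearN /= haK /= hs; apply/eqP; rewrite -addr_eq0 addrC h.
  by rewrite linearN /= -hs -he /= subrr.
exists g => x; have := hg (0, x); rewrite /= /linear_fun /= !linear0 !add0r.
by [].
Qed.

Section ExtClass.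
Variables M N : fgmod k Q.

Definition ext_class (f : {linear syz M -> N}) : Ext M N :=
  @lquot_pi k {linear syz M -> N} (@extends_pred k Q M N) f.

Lemma ext_class_linear : linear ext_class.
Proof. by move=> a x y; rewrite /ext_class lquot_piD -lquot_scaleE. Qed.

Definition ext_proj : {linear {linear syz M -> N} -> Ext M N} := make_linear ext_class_linear.

Lemma ext_proj_eq0 f : ext_proj f = 0 <-> extends (syz_incl M) f.
Proof.
rewrite -[0](linear0 ext_proj).
split; first by move/lquot_piP; rewrite subr0 => /asboolP.
by move=> h; apply/lquot_piP; rewrite subr0; apply/asboolP.
Qed.

Lemma ext_proj_surj z : exists f, ext_proj f = z.
Proof. by have [v ->] := lquot_pi_surj z; exists v. Qed.

Lemma orthP : orth M N <-> hom_le 0 M N /\ ext_le M 0 N.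
Proof.
split=> [o|[h e] [f z]].
  split; apply: cod0 => f; first by have [->] := o (f, 0).
  by apply/ext_proj_eq0; exact: (congr1 snd (o (0, ext_proj f))).
have [v <-] := ext_proj_surj z.
by rewrite (cod0E f h) (ext_proj_eq0 v).2 //; apply: (cod0E v e).
Qed.

Lemma finite_dim_HomExt : finite_dim (HomExt M N) <->
  (exists n, hom_le n M N) /\ (exists n, ext_le M n N).
Proof.
split=> [[n [b hb]]|[[n [b hb]] [m [d hd]]]].
  have sum1 (c : 'I_n -> k) : (\sum_i c i *: b i).1 = \sum_i c i *: (b i).1.
    by elim/big_rec2: _ => // i x y _ <-.
  have sum2 (c : 'I_n -> k) : (\sum_i c i *: b i).2 = \sum_i c i *: (b i).2.
    by elim/big_rec2: _ => // i x y _ <-.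
  split; exists n.
    exists (fun i => (b i).1) => f; have [c hc] := hb (f, 0); exists c.
    by rewrite -sum1 -hc /= subrr.
  have [e he] := choice (fun i => ext_proj_surj (b i).2).
  exists e => f; have [c hc] := hb (0, ext_proj f); exists c.
  apply/ext_proj_eq0; rewrite linearB linear_sum /=.
  under eq_bigr do rewrite linearZ /= he.
  by rewrite -sum2 -hc subrr.
exists (n + m)%N, (fun i => match fintype.split i with
  inl i => (b i, 0) | inr i => (0, ext_proj (d i)) end) => -[f z].
have [v <-] := ext_proj_surj z.
have [c hc] := hb f; have [c' hc'] := hd v.
exists (fun i => match fintype.split i with inl i => c i | inr i => c' i end).
rewrite big_split_ord /=.
under eq_bigr do rewrite split_lshift.
under [X in _ + X]eq_bigr do rewrite split_rshift.
have -> : \sum_i c i *: ((b i, 0) : HomExt M N) = (\sum_i c i *: b i, 0).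
  elim/big_rec2: _ => // i x y _ ->.
  by congr (_, _); rewrite /= scaler0 addr0.
have -> : \sum_i c' i *: ((0, ext_proj (d i)) : HomExt M N) = (0, ext_proj (\sum_i c' i *: d i)).
  rewrite linear_sum /=; elim/big_rec2: _ => // i x y _ ->.
  by rewrite linearZ /=; congr (_, _); rewrite /= scaler0 addr0.
have -> : ext_proj v = ext_proj (\sum_i c' i *: d i).
  by apply: subr0_eq; rewrite -linearB; apply/ext_proj_eq0.
by rewrite (subr0_eq hc); congr (_, _); rewrite /= ?addr0 ?add0r.
Qed.

End ExtClass.

End ExtModules.

(** * Classes with the two-out-of-three property *)

Section TwoOfThree.
Variables (k : fieldType) (Q : quiver).
Local Notation A := (pathalg k Q).
Local Notation fgmod := (fgmod k Q).

Definition two_of_three (T : fgmod -> Prop) : Prop :=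
  forall (L M N : fgmod) (j : {linear L -> M}) (q : {linear M -> N}),
    short_exact j q -> [/\ T L -> T N -> T M, T M -> T N -> T L & T L -> T M -> T N].

Lemma zero_mod_fg : finitely_generated ('rV[A]_0 : lmodType A).
Proof. by apply/fg_cover; exists 0%N, (lin_id _) => x; exists x. Qed.

Definition zero_mod : fgmod := FGMod zero_mod_fg.

Lemma zero_mod_zero : is_zero zero_mod.
Proof. by move=> x; apply: thinmx0. Qed.

Lemma regular_fg : finitely_generated ('rV[A]_1 : lmodType A).
Proof. by apply/fg_cover; exists 1%N, (lin_id _) => x; exists x. Qed.

Definition regular_mod : fgmod := FGMod regular_fg.

Lemma hom_to_zero (M N : lmodType A) n : is_zero N -> hom_le n M N.
Proof.
move=> z; apply: (@cod_mono _ 0) => //; apply: cod0 => f.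
by apply: hom_eq0 => x; apply: z.
Qed.

Lemma hom_from_zero (M N : lmodType A) n : is_zero M -> hom_le n M N.
Proof.
move=> z; apply: (@cod_mono _ 0) => //; apply: cod0 => f.
by apply: hom_eq0 => x; rewrite (z x) linear0.
Qed.

(** Turns invariance under isomorphism into an instance of the exact sequence bounds. *)
Lemma iso_exact (M N Z : lmodType A) (f : {linear M -> N}) : bijective f -> is_zero Z ->
  short_exact f (0 : {linear N -> Z}) /\ short_exact (0 : {linear Z -> M}) f.
Proof.
move=> [g fg gf] z; split; split.
- split=> [|x]; first exact: can_inj fg.
  by split=> // _; exists (g x).
- by move=> y; exists 0; rewrite (z y) linear0.
- split=> [x y _|x]; first by rewrite (z x) (z y).
  split=> [fx|[y <-]]; last by rewrite linear0.
  by exists 0; rewrite lin_zeroE -[RHS]fg fx -(linear0 f) fg.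
- by move=> y; exists (g y).
Qed.

Definition bounded (M N : fgmod) : Prop := exists n, hom_le n M N /\ ext_le M n N.

Lemma bounded_HomExt (M N : fgmod) : finite_dim (HomExt M N) <-> bounded M N.
Proof.
rewrite finite_dim_HomExt; split=> [[[n hn] [m hm]]|[n [hn en]]]; last by split; exists n.
exists (n + m)%N; split; first exact: (cod_mono (leq_addr _ _) hn).
exact: (cod_mono (leq_addl _ _) hm).
Qed.

Lemma hom_finiteP (M : fgmod) :
  hom_finite M <-> forall X, bounded M X /\ bounded X M.
Proof.
by split=> h X; have [h1 h2] := h X; split; apply/bounded_HomExt.
Qed.

Section Bounds.
Variables (L M N X : fgmod) (j : {linear L -> M}) (q : {linear M -> N}).
Hypothesis jq : short_exact j q.
Local Notation bnd n Y Z := (hom_le n Y Z /\ ext_le Y n Z).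

Lemma bnd_cov n m :
  [/\ bnd n X L -> bnd m X N -> bnd (n + m) X M,
      bnd n X M -> bnd m X N -> bnd (n + m) X L &
      bnd n X L -> bnd m X M -> bnd (n + m) X N].
Proof.
split=> -[h e] [h' e']; split.
- exact: (cov_hom_ext jq h h').
- exact: (ext_le_mid jq e e').
- exact: (cod_mono (leq_addr _ _) (cov_hom_ker jq h)).
- by rewrite addnC; apply: (ext_le_sub jq h' e).
- by rewrite addnC; apply: (hom_le_quot jq h' e).
- exact: (cod_mono (leq_addl _ _) (ext_le_quot jq e')).
Qed.

Lemma bnd_con n m :
  [/\ bnd n L X -> bnd m N X -> bnd (n + m) M X,
      bnd n M X -> bnd m N X -> bnd (n + m) L X &
      bnd n L X -> bnd m M X -> bnd (n + m) N X].
Proof.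
split=> -[h e] [h' e']; split.
- by rewrite addnC; apply: (con_hom_ext jq h' h).
- by rewrite addnC; apply: (ext_le_conmid jq e' e).
- exact: (hom_le_sub jq h e').
- exact: (cod_mono (leq_addr _ _) (ext_le_consub jq e)).
- exact: (cod_mono (leq_addl _ _) (con_hom_coker jq h')).
- exact: (ext_le_conquot jq h e').
Qed.

End Bounds.

Lemma two_of_three_bounded_cov X : two_of_three (bounded X).
Proof.
move=> L M N j q jq; split=> -[n h] [m h']; have [h1 h2 h3] := bnd_cov X jq n m;
  by exists (n + m)%N; auto.
Qed.

Lemma two_of_three_bounded_con X : two_of_three (bounded^~ X).
Proof.
move=> L M N j q jq; split=> -[n h] [m h']; have [h1 h2 h3] := bnd_con X jq n m;
  by exists (n + m)%N; auto.
Qed.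

Lemma two_of_three_orth_cov X : two_of_three (orth X).
Proof.
by move=> L M N j q jq; split; rewrite !orthP; have [] := bnd_cov X jq 0 0.
Qed.

Lemma two_of_three_orth_con X : two_of_three (@orth k Q ^~ X).
Proof.
by move=> L M N j q jq; split; rewrite !orthP; have [] := bnd_con X jq 0 0.
Qed.

Lemma two_of_three_closed P : abelian_closed P -> two_of_three P.
Proof.
move=> [ck cc ce] L M N j q jq; split=> [||PL PM].
- exact: (ce _ _ _ _ _ jq).
- exact: (ck _ _ _ _ _ jq.1).
by apply: (cc L M N j q) => //; split; [exact: jq.2|exact: jq.1.2].
Qed.

(** The zero module is the kernel of the identity of [M]. *)
Lemma closed_zero P M : abelian_closed P -> P M -> P zero_mod.
Proof.
move=> [ck _ _] PM; apply: (ck _ M M 0 (lin_id M)) => //; split=> [x y _|x].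
  by rewrite (zero_mod_zero x) (zero_mod_zero y).
split=> [xz|[y <-]]; last by [].
by exists 0; rewrite lin_zeroE.
Qed.

Lemma ext_from_zero (M : fgmod) (N : lmodType A) n : is_zero M -> ext_le M n N.
Proof.
move=> z; apply: (@cod_mono _ 0) => //; apply: cod0 => f.
have ip := syz_exact M.
have [|g hg] := @factor_inj _ _ _ _ _ (syz_incl M) (lin_id _) ip.1.1.
  by move=> x; apply/ip.1.2; apply: z.
exists ((f : {linear syz M -> N}) \o g) => x /=; congr (f _).
by apply: ip.1.1; rewrite hg.
Qed.

Lemma ext_to_zero (M : fgmod) (N : lmodType A) n : is_zero N -> ext_le M n N.
Proof.
move=> z; apply: (@cod_mono _ 0) => //; apply: cod0 => f.
by exists 0 => x; rewrite lin_zeroE; apply: z.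
Qed.

Lemma orth_zero (X Z : fgmod) : is_zero Z -> orth X Z /\ orth Z X.
Proof.
move=> z; rewrite !orthP; split; split.
- exact: hom_to_zero.
- exact: ext_to_zero.
- exact: hom_from_zero.
- exact: ext_from_zero.
Qed.

Lemma orth_bounded M N : orth M N -> bounded M N.
Proof. by rewrite orthP => h; exists 0%N. Qed.

Lemma two_of_three_iso T (M N : fgmod) : two_of_three T -> T zero_mod ->
  isomorphic M N -> T M -> T N.
Proof.
move=> h T0 [f fb]; have [_ e] := iso_exact fb zero_mod_zero.
by have [_ _ h3] := h _ _ _ _ _ e; apply: h3.
Qed.

Section Powers.
Variable F : fgmod.

Lemma power_exact h : exists (i : {linear {ffun 'I_h -> F} -> {ffun 'I_h.+1 -> F}})
  (p : {linear {ffun 'I_h.+1 -> F} -> F}), short_exact i p.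
Proof.
have lini : linear (fun f : {ffun 'I_h -> F} =>
    [ffun x => if unlift ord0 x is Some y then f y else 0] : {ffun 'I_h.+1 -> F}).
  move=> a f g; apply/ffunP => x; rewrite !ffunE.
  by case: unliftP => [y _|_]; rewrite ?ffunE // scaler0 addr0.
have linp : linear (fun f : {ffun 'I_h.+1 -> F} => f ord0).
  by move=> a f g; rewrite !ffunE.
exists (make_linear lini), (make_linear linp); split; last first.
  by move=> x; exists [ffun=> x]; rewrite /= /linear_fun ffunE.
split=> [f g /ffunP fg|f].
  by apply/ffunP => y; have := fg (lift ord0 y); rewrite !ffunE liftK.
rewrite /= /linear_fun; split=> [f0|[g <-]]; last by rewrite ffunE unlift_none.
exists [ffun y => f (lift ord0 y)]; apply/ffunP => x; rewrite !ffunE.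
by case: unliftP => [y ->|->]; rewrite ?ffunE // f0.
Qed.

Lemma power0_zero : is_zero {ffun 'I_0 -> F}.
Proof. by move=> f; apply/ffunP => -[]. Qed.

Lemma power_fg h : finitely_generated ({ffun 'I_h -> F} : lmodType A).
Proof.
elim: h => [|h IH].
  apply: (fg_quot (M := zero_mod) (q := 0)); last exact: zero_mod_fg.
  by move=> f; exists 0; rewrite (power0_zero f) linear0.
by have [i [p ip]] := power_exact h; apply: (fg_ext ip IH (fgmodP F)).
Qed.

Definition power h : fgmod := FGMod (power_fg h).

Lemma two_of_three_power T h : two_of_three T -> T zero_mod -> T F -> T (power h).
Proof.
move=> hT T0 TF; elim: h => [|h IH].
  apply: (two_of_three_iso hT T0 _ T0); exists 0, 0 => x.
    by rewrite !lin_zeroE (zero_mod_zero x).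
  by rewrite !lin_zeroE (power0_zero x).
have [i [p ip]] := power_exact h.
by have [h1 _ _] := hT (power h) (power h.+1) F i p ip; apply: h1.
Qed.

Lemma hom0_power (X : lmodType A) h : hom_le 0 F X -> hom_le 0 {ffun 'I_h -> F} X.
Proof.
move=> hF; elim: h => [|h IH]; first exact: (hom_from_zero _ _ power0_zero).
have [i [p ip]] := power_exact h.
exact: (con_hom_ext ip hF IH).
Qed.

Lemma universal_lift (M : fgmod) h (u : {linear {ffun 'I_h -> F} -> M})
    (f : {linear F -> M}) : universal_hom u ->
  exists g : {linear F -> {ffun 'I_h -> F}}, forall x, u (g x) = f x.
Proof. by move=> [v _ uv]; exists (v f) => x; rewrite -{2}[f]uv. Qed.

Lemma universal_inj (M : fgmod) h (u : {linear {ffun 'I_h -> F} -> M})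
    (f : {linear F -> {ffun 'I_h -> F}}) :
  universal_hom u -> (forall x, u (f x) = 0) -> f = 0.
Proof.
move=> ub uf; apply: (bij_inj ub); apply: linearP_eq => x.
by rewrite /= uf; apply/esym/(linear0 u).
Qed.

End Powers.

Lemma image_factor (U V : lmodType A) (u : {linear U -> V}) :
  exists (K I C : lmodType A) (i : {linear K -> U}) (e : {linear U -> I})
    (m : {linear I -> V}) (q : {linear V -> C}),
  [/\ short_exact i e, short_exact m q, is_kernel i u, is_cokernel u q &
    forall x, m (e x) = u x].
Proof.
have [K [i hi]] := kernel_exists u; have [C [q hq]] := cokernel_exists u.
have [I [m hm]] := kernel_exists q.
have [e he] : exists e : {linear U -> I}, forall x, m (e x) = u x.
  by apply: (factor_inj hm.1) => x; apply/hm.2/hq.2; exists x.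
exists K, I, C, i, e, m, q; split=> //; last by split=> //; case: hq.
split.
  split=> [|x]; first exact: hi.1.
  rewrite -(hi.2 x) -he; split=> [->|]; first by rewrite linear0.
  by rewrite -{1}(linear0 m); apply: hm.1.
move=> y; have /hq.2 [x hx] : q (m y) = 0 by apply/hm.2; exists y.
by exists x; apply: hm.1; rewrite he.
Qed.

End TwoOfThree.

(** * Reflections and mutations *)

Section Reflection.
Variables (k : fieldType) (Q : quiver).
Local Notation A := (pathalg k Q).
Local Notation fgmod := (fgmod k Q).

(* Iterated extensions of [C] by copies of [F], with the inclusion of [C].
   They replace the one-step universal extension by a power of [F]. *)
Inductive tower (F C : fgmod) : forall T : fgmod, {linear C -> T} -> Prop :=
| tower_refl : tower F (lin_id C)
| tower_step (T T' : fgmod) (j : {linear C -> T}) (i : {linear T -> T'})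
    (p : {linear T' -> F}) :
    tower F j -> short_exact i p -> @tower F C T' (i \o j).

Section Tower.
Variables (F C T : fgmod) (j : {linear C -> T}).
Hypothesis tj : tower F j.

Lemma tower_inj : injective j.
Proof. by elim: tj => // T0 T' j0 i p _ j0i ip x y /= /ip.1.1 /j0i. Qed.

Lemma tower_two_of_three R : two_of_three R -> R F -> R C <-> R T.
Proof.
move=> hR RF; elim: tj => // T0 T' j0 i p _ -> ip.
by have [h1 h2 _] := hR _ _ _ _ _ ip; split=> h; auto.
Qed.

(** At each step, vanishing of [Ext(F, N)] gives the extension of the map and vanishing of
    [Hom(F, N)] its uniqueness. *)
Lemma tower_extend (N : fgmod) (f : {linear C -> N}) : orth F N ->
  exists g : {linear T -> N}, (forall x, g (j x) = f x) /\
    forall g' : {linear T -> N}, (forall x, g' (j x) = f x) -> g' = g.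
Proof.
move=> /orthP [h e]; elim: tj => [|T0 T' j0 i p _ [g0 [g0j u0]] ip].
  by exists f; split=> // g' hg'; apply: linearP_eq.
have [g gi] := ext0_extend g0 ip e.
exists g; split=> [x|g' g'j]; first by rewrite /= gi.
have g'i : (g' \o i : {linear T0 -> N}) = g0 by apply: u0.
have [|d hd] := factor_surj (p := p) (f := g' \- g) ip.2.
  move=> x /ip.1.2 [y <-] /=.
  by rewrite gi -g'i subrr.
apply: linearP_eq => x; apply: subr0_eq; rewrite -[LHS]hd.
by rewrite (cod0E d h).
Qed.

Lemma tower_hom_con (X : lmodType A) n : hom_le 0 F X -> hom_le n C X -> hom_le n T X.
Proof.
move=> hF hC; elim: tj => // T0 T' j0 i p _ h ip.
exact: (con_hom_ext ip hF h).
Qed.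

Lemma tower_ext_con (X : lmodType A) n : ext_le F 0 X -> ext_le C n X -> ext_le T n X.
Proof.
move=> hF hC; elim: tj => // T0 T' j0 i p _ h ip.
exact: (ext_le_conmid ip hF h).
Qed.

Lemma tower_hom_cov (X : lmodType A) n : hom_le 0 X F -> hom_le n X C -> hom_le n X T.
Proof.
move=> hF hC; elim: tj => // T0 T' j0 i p _ h ip.
by have := cov_hom_ext ip h hF; rewrite addn0.
Qed.

Lemma tower_ext_cov (X : fgmod) n : ext_le X 0 F -> ext_le X n C -> ext_le X n T.
Proof.
move=> hF hC; elim: tj => // T0 T' j0 i p _ h ip.
by have := ext_le_mid ip h hF; rewrite addn0.
Qed.

End Tower.

(** Realizes a cocycle [f] by an extension, the quotient of [C] plus the free cover by the pairs
    [(f s, - s)]. *)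
Lemma pushout (M C : fgmod) (f : {linear syz M -> C}) :
  exists (X : fgmod) (j : {linear C -> X}) (q : {linear X -> M})
    (g : {linear 'rV[A]_(ngens M) -> X}),
  [/\ short_exact j q, forall x, g (syz_incl M x) = j (f x) & forall x, q (g x) = pres M x].
Proof.
have ip := syz_exact M; set i := syz_incl M; set p := pres M; set P := 'rV[A]_(ngens M).
have lr : linear (fun s : syz M => (f s, - i s) : C * P).
  by move=> a x y; congr (_, _); rewrite /= linearP // opprD scalerN.
have [X [pi hX]] := cokernel_exists (make_linear lr).
have lj : linear (fun c : C => (c, 0) : C * P).
  by move=> a x y; congr (_, _); rewrite /= scaler0 addr0.
have lg : linear (fun x : P => (0, x) : C * P).
  by move=> a x y; congr (_, _); rewrite /= scaler0 addr0.
have lp : linear (fun z : C * P => p z.2) by move=> a x y; rewrite /= linearP.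
pose j : {linear C -> X} := pi \o make_linear lj.
pose g : {linear P -> X} := pi \o make_linear lg.
have [|q hq] := factor_surj (p := pi) (f := make_linear lp) hX.1.
  move=> z /hX.2 [s <-]; rewrite /= /linear_fun /= linearN /=.
  by rewrite (_ : p (i s) = 0) ?oppr0 //; apply/ip.1.2; exists s.
have piE c x : pi (c, x) = j c + g x.
  rewrite /j /g /= -linearD /=; congr (pi _).
  by congr (_, _); rewrite /= /linear_fun /= ?addr0 ?add0r.
have gE s : g (i s) = j (f s).
  by apply/esym/subr0_eq; rewrite -(linearN g) -piE; apply/hX.2; exists s.
have qg x : q (g x) = p x by rewrite /g /= hq.
have qj c : q (j c) = 0 by rewrite /j /= hq /= /linear_fun /= linear0.
have jq : short_exact j q.
  split; last by move=> m; have [x <-] := ip.2 m; exists (g x).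
  split=> [|x].
    apply: linear_injP => c jc; have /hX.2 [s hs] : pi (c, 0) = 0.
      by rewrite piE jc linear0 addr0.
    have hs1 : f s = c := congr1 fst hs.
    have hs2 : - i s = 0 := congr1 snd hs.
    have s0 : s = 0.
      apply: ip.1.1; rewrite linear0; apply/eqP; rewrite -oppr_eq0; exact/eqP.
    by rewrite -hs1 s0 linear0.
  split=> [|[c <-] //]; have [[c y] <-] := hX.1 x; rewrite piE linearD qj qg add0r.
  by move=> /ip.1.2 [s <-]; exists (c + f s); rewrite linearD gE.
have fgX : finitely_generated X := fg_ext jq (fgmodP C) (fgmodP M).
by exists (FGMod fgX), j, q, g; split.
Qed.

(** * Reflection into the right orthogonal of an exceptional module *)

Section Exceptional.
Variables (E : fgmod).
Hypothesis excE : exceptional E.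

Lemma exc_id : lin_id E <> 0.
Proof.
by case: excE => + _ _ e0; rewrite /hom_id e0 => /eqP; apply.
Qed.

Lemma exc_nonzero : ~ is_zero E.
Proof. by move=> z; apply: exc_id; apply: hom_eq0 => x; apply: z. Qed.

Lemma exc_end (f : {linear E -> E}) : exists a : k, forall x, f x = pscalar Q a *: x.
Proof.
have [_ /(_ (f, 0)) [a ha] _] := excE; exists a => x.
by have -> : f = a *: lin_id E := congr1 fst ha.
Qed.

Lemma exc_hom_le : hom_le 1 E E.
Proof.
exists (fun=> lin_id E) => f; have [a ha] := exc_end f; exists (fun=> a).
rewrite big_ord1; apply: hom_eq0 => x.
by rewrite lin_addE lin_oppE lin_scaleE ha subrr.
Qed.

Lemma exc_ext_le : ext_le E 0 E.
Proof.
apply: cod0 => f; apply/ext_proj_eq0.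
have [_ /(_ (0, ext_proj _ _ f)) [a ha] _] := excE.
by have := congr1 snd ha; rewrite /= scaler0.
Qed.

Lemma exc_bounded X : bounded E X /\ bounded X E.
Proof. by case: excE => _ _ /hom_finiteP. Qed.

(** The components of [u] are a basis of [Hom(E, M)]. Since every endomorphism of [E] is a scalar,
    maps from [E] to its [h]-th power are coefficient tuples. *)
Lemma universal_exists (M : fgmod) :
  exists h (u : {linear {ffun 'I_h -> E} -> M}), universal_hom u.
Proof.
have [[n [hn _]] _] := exc_bounded M.
have [h [b [_ span ind]]] := cod_basis (@subspace_eq0 _ _) hn.
have lin : linear (fun x : {ffun 'I_h -> E} => \sum_i (b i : {linear E -> M}) (x i)).
  move=> a x y; rewrite scaler_sumr -big_split; apply: eq_bigr => i _ /=.
  by rewrite !ffunE linearP.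
exists h, (make_linear lin).
have sumE (c : 'I_h -> k) x : (\sum_i c i *: b i : {linear E -> M}) x =
    \sum_i (b i : {linear E -> M}) (pscalar Q (c i) *: x).
  rewrite (eq_bigr (fun i => pscalar Q (c i) *: (b i : {linear E -> M}) x)).
    by elim/big_rec2: _ => // i y1 y2 _ <-.
  by move=> i _; rewrite linearZ.
have lift (f : {linear E -> M}) : exists g : {linear E -> {ffun 'I_h -> E}},
    (make_linear lin \o g : {linear E -> M}) = f.
  have [c hc] := span f.
  have ling : linear (fun x : E => [ffun i => pscalar Q (c i) *: x] : {ffun 'I_h -> E}).
    by move=> a x y; apply/ffunP => i; rewrite !ffunE scalerDr !scalerA pscalarC.
  exists (make_linear ling); apply: linearP_eq => x.
  rewrite (subr0_eq hc) sumE /= /linear_fun.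
  by apply: eq_bigr => i _; rewrite ffunE.
have [v hv] := choice lift.
exists v => [g|//].
apply: subr0_eq; set d : {linear E -> {ffun 'I_h -> E}} := v _ - g.
have ud x : make_linear lin (d x) = 0.
  rewrite lin_addE lin_oppE linearB /=; apply/eqP; rewrite subr_eq0; apply/eqP.
  have := hv (make_linear lin \o g) => /(congr1 (fun f : {linear _ -> _} => f x)).
  by [].
have lind i : linear (fun x => d x i) by move=> a x y; rewrite linearP !ffunE.
have [c hc] := choice (fun i => exc_end (make_linear (lind i))).
have c0 : forall i, c i = 0.
  apply: ind; apply: hom_eq0 => x; rewrite sumE -[RHS](ud x) /= /linear_fun.
  by apply: eq_bigr => i _; rewrite -hc.
apply: hom_eq0 => x; apply/ffunP => i; rewrite [RHS]ffunE.
have -> : d x i = pscalar Q (c i) *: x := hc i x.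
by rewrite c0 /pscalar !scale0r.
Qed.

(** An extension of [E] by [T] along a non-zero class lowers the bound on [Ext(E, T)] and preserves
    [Hom(E, T) = 0]; induct on that bound. *)
Lemma tower_exists n (C T : fgmod) (j : {linear C -> T}) : tower E j ->
  hom_le 0 E T -> ext_le E n T ->
  exists (T' : fgmod) (j' : {linear C -> T'}), tower E j' /\ orth E T'.
Proof.
have [m le] := ubnP n; elim: m n le T j => // m IH n le T j tj h e.
have [m' [b [lem span ind]]] := cod_basis (@subspace_extends _ _ _ _ _ _) e.
case: m' b lem span ind => [|m'] b lem span ind.
  by exists T, j; split=> //; apply/orthP; split=> //; exists b.
have [X [i [q [g [iq gi qg]]]]] := pushout (b ord0).
apply: (IH m' _ X (i \o j)).
- by apply: leq_trans lem _; rewrite -ltnS.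
- exact: tower_step tj iq.
- apply: cod0 => phi.
  have [c hc] := exc_end (q \o phi).
  have [c0|c0] := eqVneq c 0.
    have [|d hd] := @lift_sub _ _ _ _ _ _ _ iq _ phi.
      by move=> x; have := hc x; rewrite /= c0 /pscalar !scale0r.
    by apply: hom_eq0 => x; rewrite -hd (cod0E d h) linear0.
  (* A non-zero scalar [c] would make [s] a section of [q], so the extension would split and the
     class of [b ord0] would vanish, against independence. *)
  pose s : {linear E -> X} := c^-1 *: (phi : {linear E -> X}).
  have qs x : q (s x) = x.
    rewrite lin_scaleE linearZ /=; have /= -> := hc x.
    by rewrite scalerA -pscalarM mulVf // pscalar1 scale1r.
  have [|d hd] := @lift_sub _ _ _ _ _ _ _ iq _ (g \- (s \o pres E)).
    by move=> x; rewrite /= linearB /= qs qg subrr.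
  suff /(ind (fun l => (l == ord0)%:R)) /(_ ord0)/eqP : extends (syz_incl E)
      (\sum_l ((l == ord0)%:R : k) *: b l : {linear syz E -> T}).
    by rewrite /= oner_eq0.
  rewrite (bigD1 ord0) //= scale1r big1 ?addr0 => [|l /negPf ->]; last by rewrite scale0r.
  exists d => x; apply: iq.1.1; rewrite hd /= gi.
  have -> : pres E (syz_incl E x) = 0 by apply/(syz_exact E).1.2; exists x.
  by rewrite linear0 subr0.
(* The quotient by [R] is [Ext(E, T)] modulo the class of [b ord0]. It maps onto [Ext(E, X)],
   because [Ext(E, E) = 0]. *)
pose R (w : {linear syz E -> T}) := exists c : k, extends (syz_incl E) (w - c *: b ord0).
have hR : cod m' R.
  exists (fun l => b (lift ord0 l)) => w; have [c hc] := span w.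
  exists (fun l => c (lift ord0 l)); exists (c ord0).
  by rewrite big_ord_recl opprD addrA addrAC in hc.
apply: (cod_exact0r (F := post_rel i)) hR => //.
- exact: subspace_extends.
- exact: post_rel_linear.
- move=> w v wv [c [d hd]]; exists ((i \o d) + c *: g : {linear _ -> _}) => x.
  rewrite lin_addE lin_scaleE /= -hd gi lin_addE lin_oppE lin_scaleE linearB linearZ /=.
  by rewrite subrK wv.
move=> v; have [a ha] := cod0E (q \o (v : {linear _ -> _}) : {linear _ -> _}) exc_ext_le.
have [a' ha'] := @row_projective _ _ _ _ _ q a iq.2.
have [|w hw] := @lift_sub _ _ _ _ _ _ _ iq _ (v \- (a' \o syz_incl E)).
  by move=> x; rewrite /= linearB /= ha' -ha subrr.
exists w, (i \o w : {linear syz E -> X}); split=> //; exists a' => x.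
by rewrite lin_addE lin_oppE /= hw /= opprB addrC subrK.
Qed.

Lemma ext0_power (X F : fgmod) h : ext_le X 0 F -> ext_le X 0 {ffun 'I_h -> F}.
Proof.
move=> hF; elim: h => [|h IH]; first exact: (ext_to_zero _ _ (@power0_zero _ _ F)).
have [i [p ip]] := power_exact F h.
exact: (ext_le_mid ip IH hF).
Qed.

(** The image of [u] is a quotient of a power of [E], so [Ext(E, -)] vanishes on it. Maps from [E]
    to [C] thus lift to [M], hence through [u], and die in [C]. *)
Lemma universal_coker (M C : fgmod) h (u : {linear {ffun 'I_h -> E} -> M})
    (q : {linear M -> C}) : universal_hom u -> is_cokernel u q -> hom_le 0 E C.
Proof.
move=> uu hq.
have [K [I [C' [i [e [m [q' [ie mq' hi hq' me]]]]]]]] := image_factor u.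
have mq : short_exact m q.
  split; last exact: hq.1.
  split; first exact: mq'.1.1.
  by move=> x; rewrite hq.2 -hq'.2; apply: mq'.1.2.
have eI : ext_le E 0 I := ext_le_quot ie (ext0_power h exc_ext_le).
apply: cod0 => f; have [g hg] := ext0_lift mq f eI.
have [g' hg'] := universal_lift g uu.
by apply: hom_eq0 => x; rewrite -hg -hg'; apply/hq.2; exists (g' x).
Qed.

Definition reflects (M T : fgmod) (eta : {linear M -> T}) : Prop :=
  orth E T /\ forall N : fgmod, orth E N -> forall f : {linear M -> N},
    exists g : {linear T -> N}, (forall x, g (eta x) = f x) /\
      forall g' : {linear T -> N}, (forall x, g' (eta x) = f x) -> g' = g.

(** A map from [M] to a module of the orthogonal kills the image of [u], so it descends to [C], then
    extends uniquely along the tower. *)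
Lemma tower_reflects (M C T : fgmod) h (u : {linear {ffun 'I_h -> E} -> M})
    (q : {linear M -> C}) (j : {linear C -> T}) :
  is_cokernel u q -> tower E j -> orth E T -> reflects (j \o q).
Proof.
move=> hq tj o; split=> // N oN f.
have [|f' hf'] := factor_surj (p := q) (f := f) hq.1.
  move=> x /hq.2 [y <-].
  have fu : (f \o u : {linear {ffun 'I_h -> E} -> N}) = 0.
    exact: cod0E (hom0_power h ((orthP _ _).1 oN).1).
  by rewrite -[LHS]/((f \o u : {linear {ffun 'I_h -> E} -> N}) y) fu.
have [g [hg ug]] := tower_extend tj f' oN.
exists g; split=> [x|g' hg']; first by rewrite /= hg hf'.
by apply: ug => c; have [x <-] := hq.1 c; rewrite hf' -hg'.
Qed.

(** The last clause holds because the image of [u] is both a submodule of [M], which controls Hom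
    from [X], and a quotient of a power of [E], which controls Ext. *)
Lemma reflection_exists (M : fgmod) h (u : {linear {ffun 'I_h -> E} -> M}) :
  universal_hom u ->
  exists (C T : fgmod) (q : {linear M -> C}) (j : {linear C -> T}),
  [/\ is_cokernel u q, tower E j, orth E T &
      forall X, orth X E -> orth X M -> orth X T].
Proof.
move=> uu; have [C [q hq]] := cokernel_exists u.
pose C' : fgmod := FGMod (fg_quot hq.1 (fgmodP M)).
have hC : hom_le 0 E C' := @universal_coker M C' h u q uu hq.
have [[n [_ eC]] _] := exc_bounded C'.
have [T [j [tj oT]]] := tower_exists (tower_refl E C') hC eC.
exists C', T, q, j; split=> // X oE oM.
apply/(tower_two_of_three tj (@two_of_three_orth_cov k Q X) oE).
have [K [I [C0 [i [e [m [q' [ie mq' hi hq' me]]]]]]]] := image_factor u.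
pose I' : fgmod := FGMod (fg_quot ie.2 (fgmodP (power E h))).
have mq : short_exact (m : {linear I' -> M}) (q : {linear M -> C'}).
  split; last exact: hq.1.
  split; first exact: mq'.1.1.
  by move=> x; rewrite hq.2 -hq'.2; apply: mq'.1.2.
have [_ _ h3] := two_of_three_orth_cov X mq.
apply: h3 => //; apply/orthP; split.
  exact: (cov_hom_ker mq ((orthP _ _).1 oM).1).
exact: (ext_le_quot ie (ext0_power h ((orthP _ _).1 oE).2)).
Qed.

Lemma reflects_unique (M T N : fgmod) (eta : {linear M -> T}) (g g' : {linear T -> N}) :
  reflects eta -> orth E N -> (forall x, g (eta x) = g' (eta x)) -> g = g'.
Proof.
move=> [_ h] oN e; have [g0 [_ u]] := h N oN (g \o eta).
by rewrite (u g) // (u g') // => x; rewrite /= e.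
Qed.

Lemma reflects_iso (M T T' : fgmod) (eta : {linear M -> T}) (eta' : {linear M -> T'}) :
  reflects eta -> reflects eta' ->
  exists f : {linear T -> T'}, bijective f /\ forall x, f (eta x) = eta' x.
Proof.
move=> r r'; have [f [hf _]] := r.2 _ r'.1 eta'; have [g [hg _]] := r'.2 _ r.1 eta.
exists f; split=> //; exists g => x.
  apply: (congr1 (fun h : {linear T -> T} => h x) (_ : (g \o f : {linear T -> T}) = lin_id T)).
  by apply: (reflects_unique r r.1) => y; rewrite /= hf hg.
apply: (congr1 (fun h : {linear T' -> T'} => h x) (_ : (f \o g : {linear T' -> T'}) = lin_id T')).
by apply: (reflects_unique r' r'.1) => y; rewrite /= hg hf.
Qed.

End Exceptional.

(** The identity is a non-zero multiple of the spanning vector of [Hom(E, E)], so it spans as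
    well. *)
Lemma exceptional_dims (E : fgmod) : hom_le 1 E E -> ext_le E 0 E -> ~ is_zero E ->
  hom_finite E -> exceptional E.
Proof.
move=> [b hb] e0 nz fin.
have id0 : lin_id E <> 0.
  by move=> e; apply: nz => x; rewrite -[LHS]/(lin_id E x) e.
split=> //.
  by apply/eqP => /(congr1 fst) /id0.
have [c] := hb (lin_id E); rewrite big_ord1 => /subr0_eq hc.
have c0 : c ord0 != 0 by apply/eqP => c0; apply: id0; rewrite hc c0 scale0r.
move=> [f z]; have [v <-] := ext_proj_surj z.
rewrite ((ext_proj_eq0 v).2 (cod0E v e0)).
have [d] := hb f; rewrite big_ord1 => /subr0_eq hd.
exists (d ord0 / c ord0); congr (_, _); last by rewrite /= scaler0.
by rewrite /= hd hc scalerA divfK.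
Qed.

Lemma exceptional_iso (E E' : fgmod) : isomorphic E' E -> exceptional E -> exceptional E'.
Proof.
move=> [g [f gf fg]] exc.
have gb : bijective g by exists f.
have [e1 e2] := iso_exact gb (@zero_mod_zero k Q).
have z := @zero_mod_zero k Q.
apply: exceptional_dims.
- have h := exc_hom_le exc.
  apply: (cov_hom_ker e1).
  exact: (con_hom_ext e2 h (hom_from_zero E 0 z)).
- have h := exc_ext_le exc.
  have h' : ext_le E' 0 E.
    by apply: (ext_le_consub e1 h).
  exact: (ext_le_sub e1 (hom_to_zero E' 0 z) h').
- by move=> zE'; apply: (exc_nonzero exc) => x; rewrite -[x]fg (zE' (f x)) linear0.
have b X := exc_bounded exc X.
apply/hom_finiteP => X; have [b1 b2] := b X.
have [z1 z2] := orth_zero X z.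
have [_ h1 _] := @two_of_three_bounded_con k Q X _ _ _ _ _ e1.
have [_ h2 _] := @two_of_three_bounded_cov k Q X _ _ _ _ _ e1.
split; [apply: h1 => //|apply: h2 => //]; exact: orth_bounded.
Qed.

(** * Mutation of an exceptional pair *)

Section Mutation.
Variables E F : fgmod.
Hypotheses (excE : exceptional E) (excF : exceptional F) (EF : orth E F).

Lemma orth_power h : orth E (power F h).
Proof.
apply: (two_of_three_power (T := orth E)) => //; first exact: two_of_three_orth_cov.
by case: (orth_zero E (@zero_mod_zero k Q)).
Qed.

(* If [Hom(E, I) <> 0] for the image [I] of [u], then [I = E] because [End(E)]
   is the field.  Otherwise [Ext(E, K) = 0] for the kernel [K] of [u], hence
   [Ext(I, K) = 0], so that [K] is a summand of a power of [F]; but there are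
   no homomorphisms from [F] to [K]. *)
Lemma universal_mono_or_epi h (u : {linear {ffun 'I_h -> F} -> E}) :
  universal_hom u -> injective u \/ Defs.surjective u.
Proof.
move=> uu; have [K [I [C [i [e [m [q [ie mq hi hq me]]]]]]]] := image_factor u.
pose I' : fgmod := FGMod (fg_quot ie.2 (fgmodP (power F h))).
pose C' : fgmod := FGMod (fg_quot hq.1 (fgmodP E)).
have hFK : hom_le 0 F K.
  apply: cod0 => f.
  have if0 : (i \o f : {linear F -> {ffun 'I_h -> F}}) = 0.
    by apply: (universal_inj uu) => x; apply/hi.2; exists (f x).
  apply: hom_eq0 => x; apply: hi.1; rewrite linear0.
  by rewrite -[LHS]/((i \o f : {linear F -> {ffun 'I_h -> F}}) x) if0.
have [hEI|/existsNP [f f0]] := pselect (forall f : {linear E -> I}, f = 0); last first.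
  right => y.
  have [a ha] := exc_end excE (m \o f).
  have a0 : a != 0.
    apply/eqP => a0; apply: f0; apply: hom_eq0 => x; apply: mq.1.1.
    by have := ha x; rewrite a0 /= => ->; rewrite /pscalar !scale0r linear0.
  have [x hx] := ie.2 (f (pscalar Q a^-1 *: y)); exists x.
  rewrite -me hx; have /= -> := ha (pscalar Q a^-1 *: y).
  by rewrite scalerA -pscalarM mulfV // pscalar1 scale1r.
left; have [hP eP] := (orthP _ _).1 (@orth_power h).
(* [Ext(E, K)] lies between [Hom(E, I) = 0] and Ext from [E] to a power of [F], which vanishes;
   [Ext(I, K)] is a quotient of it. *)
have eEK : ext_le E 0 K := ext_le_sub ie (cod0 hEI) eP.
have eIK : ext_le I' 0 K.
  exact: (@ext_le_consub k Q I' E C' m q mq K 0 eEK).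
have [g hg] := @ext0_extend k Q I' K _ K i e (lin_id K) ie eIK.
have g0 : g = 0 := cod0E g (hom0_power h hFK).
apply: linear_injP => x /hi.2 [y <-].
by rewrite -[y]/(lin_id K y) -hg g0 lin_zeroE linear0.
Qed.

Lemma isomorphic_sym (M N : fgmod) : isomorphic M N -> isomorphic N M.
Proof.
move=> [f [g fg gf]].
have gl : linear g.
  by move=> a x y; apply: (can_inj fg); rewrite linearP !gf.
by exists (make_linear gl), f.
Qed.

Section Mono.
Variables (h : nat) (u : {linear {ffun 'I_h -> F} -> E}) (C T : fgmod)
  (q : {linear E -> C}) (j : {linear C -> T}).
Hypotheses (ui : injective u) (hq : is_cokernel u q) (tj : tower F j) (FT : orth F T).

Lemma mono_exact : short_exact (u : {linear power F h -> E}) q.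
Proof. by split; [split=> //; case: hq|case: hq]. Qed.

Lemma mono_two_of_three R : two_of_three R -> R (zero_mod k Q) -> R F -> R E <-> R T.
Proof.
move=> hR R0 RF; rewrite -(tower_two_of_three tj hR RF).
have [h1 _ h3] := hR _ _ _ _ _ mono_exact.
have RP := two_of_three_power h hR R0 RF.
by split; [apply: h3|apply: h1].
Qed.

(** The bounds pass from [(E, E)] to [(E, C)], [(E, T)], [(C, T)] and [(T, T)]. The second argument
    changes by copies of [F], invisible from [E], and the first by copies of [F], which do not see
    [T]. *)
Lemma mono_exceptional : ~ is_zero T -> exceptional T.
Proof.
move=> nz.
have [hEF eEF] := (orthP _ _).1 EF; have [hEP eEP] := (orthP _ _).1 (@orth_power h).
have [hFT eFT] := (orthP _ _).1 FT.
have hEC : hom_le 1 E C := hom_le_quot mono_exact (exc_hom_le excE) eEP.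
have eEC : ext_le E 0 C := ext_le_quot mono_exact (exc_ext_le excE).
have hET : hom_le 1 E T := tower_hom_cov tj hEF hEC.
have eET : ext_le E 0 T := tower_ext_cov tj eEF eEC.
have hPT : hom_le 0 (power F h) T := hom0_power h hFT.
apply: exceptional_dims => //.
- exact: (tower_hom_con tj hFT (con_hom_coker mono_exact hET)).
- exact: (tower_ext_con tj eFT (ext_le_conquot mono_exact hPT eET)).
apply/hom_finiteP => X; have [b1 b2] := exc_bounded excE X.
have [c1 c2] := exc_bounded excF X; have [z1 z2] := orth_zero X (@zero_mod_zero k Q).
split.
  apply/(mono_two_of_three (two_of_three_bounded_con X)) => //; exact: orth_bounded.
apply/(mono_two_of_three (two_of_three_bounded_cov X)) => //; exact: orth_bounded.
Qed.

End Mono.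

Section Epi.
Variables (h : nat) (u : {linear {ffun 'I_h -> F} -> E}) (E' : fgmod)
  (j : {linear E' -> {ffun 'I_h -> F}}).
Hypotheses (uu : universal_hom u) (us : Defs.surjective u) (ju : is_kernel j u).

Lemma epi_exact : short_exact (j : {linear E' -> power F h}) u.
Proof. by []. Qed.

Lemma epi_two_of_three R : two_of_three R -> R (zero_mod k Q) -> R F -> R E <-> R E'.
Proof.
move=> hR R0 RF; have [_ h2 h3] := hR _ _ _ _ _ epi_exact.
have RP := two_of_three_power h hR R0 RF.
by split=> ?; [apply: h2|apply: h3].
Qed.

(** Hom vanishes by the injective half of universality; Ext vanishes by the surjective half,
    together with [Ext(F, F) = 0]. *)
Lemma epi_orth : orth F E'.
Proof.
apply/orthP; split.
  apply: cod0 => f; apply: hom_eq0 => x; apply: ju.1; rewrite linear0.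
  have jf0 : (j \o f : {linear F -> {ffun 'I_h -> F}}) = 0.
    by apply: (universal_inj uu) => y; apply/ju.2; exists (f y).
  by rewrite -[LHS]/((j \o f : {linear F -> {ffun 'I_h -> F}}) x) jf0.
apply: (ext0_sub epi_exact) => [f|]; first exact: universal_lift uu.
exact: (ext0_power h (exc_ext_le excF)).
Qed.

(** Two shifts of degree cancel: [Hom(E, E)] bounds [Ext(E, E')], which bounds [Hom(E', E')]. The
    space [Ext(E', E')] is a quotient of Ext from a power of [F] to [E'], which vanishes. *)
Lemma epi_exceptional : exceptional E'.
Proof.
have [hEP eEP] := (orthP _ _).1 (@orth_power h).
have [hFE eFE] := (orthP _ _).1 epi_orth.
have oPE : orth (power F h) E'.
  apply: (two_of_three_power (T := (@orth k Q)^~ E')) => //.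
  - exact: two_of_three_orth_con.
  - by case: (orth_zero E' (@zero_mod_zero k Q)).
  - exact: epi_orth.
have [hPE ePE] := (orthP _ _).1 oPE.
apply: exceptional_dims.
- exact: (hom_le_sub epi_exact hPE (ext_le_sub epi_exact (exc_hom_le excE) eEP)).
- exact: (ext_le_consub epi_exact ePE).
(* If [E'] were zero, [E] would embed in a power of [F], against [Hom(E, F) = 0]. *)
- move=> zE'; have ui : injective u.
    by apply: linear_injP => x /ju.2 [y <-]; rewrite (zE' y) linear0.
  have [|w hw] := factor_inj (f := lin_id E) ui; first by move=> y; exact: us.
  apply: (exc_nonzero excE) => x; rewrite -[x]/(lin_id E x) -hw (cod0E w hEP).
  by rewrite lin_zeroE linear0.
apply/hom_finiteP => X; have [b1 b2] := exc_bounded excE X.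
have [c1 c2] := exc_bounded excF X; have [z1 z2] := orth_zero X (@zero_mod_zero k Q).
split.
  apply/(epi_two_of_three (two_of_three_bounded_con X)) => //; exact: orth_bounded.
apply/(epi_two_of_three (two_of_three_bounded_cov X)) => //; exact: orth_bounded.
Qed.

End Epi.

Variables (P : fgmod) (eta : {linear E -> P}).
Hypothesis etaP : reflects F eta.

(** The reflection is a tower over the cokernel of [u], so it contains that cokernel, and its
    identity is determined by the map from [E], which factors through the cokernel. *)
Lemma zero_reflection h (u : {linear {ffun 'I_h -> F} -> E}) : universal_hom u ->
  is_zero P <-> Defs.surjective u.
Proof.
move=> uu; have [C [T [q [j [hq tj oT _]]]]] := reflection_exists excF uu.
have rT := tower_reflects hq tj oT.
split=> [z y|us].
  have [f [_ hf]] := reflects_iso etaP rT.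
  by apply/hq.2; apply: (tower_inj tj); rewrite -[LHS]hf (z (eta y)) !linear0.
have id0 : lin_id P = 0.
  have [f [_ hf]] := reflects_iso rT etaP.
  apply: (reflects_unique etaP etaP.1) => y; rewrite lin_zeroE /= -hf /=.
  by rewrite (_ : q y = 0) ?linear0 //; apply/hq.2; apply: us.
by move=> x; rewrite -[x]/(lin_id P x) id0.
Qed.

Lemma mutation (E' : fgmod) :
  (is_zero P /\ exists h (u : {linear {ffun 'I_h -> F} -> E})
     (j : {linear E' -> {ffun 'I_h -> F}}), universal_hom u /\ is_kernel j u)
  \/ (~ is_zero P /\ isomorphic E' P) ->
  [/\ exceptional E', orth F E' &
      forall R, two_of_three R -> R (zero_mod k Q) -> R F -> R E <-> R E'].
Proof.
move=> [[z [h [u [j [uu ju]]]]]|[nz isoE]].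
  have us := (zero_reflection uu).1 z.
  split; [exact: epi_exceptional ju|exact: epi_orth ju|].
  by move=> R; apply: (epi_two_of_three us ju).
have [h [u uu]] := universal_exists excF E.
have [C [T [q [j [hq tj oT _]]]]] := reflection_exists excF uu.
(* A non-zero reflection excludes surjectivity of [u]. *)
have ui : injective u.
  by case: (universal_mono_or_epi uu) => // /(zero_reflection uu).
have [f [fb _]] := reflects_iso etaP (tower_reflects hq tj oT).
have [g hg] := isoE.
have isoT : isomorphic E' T by exists (f \o g); apply: bij_comp.
have isoT' := isomorphic_sym isoT.
have nzT : ~ is_zero T.
  by move=> zT; apply: nz => x; apply: (bij_inj fb); rewrite [LHS]zT linear0.
split.
- exact: (exceptional_iso isoT (mono_exceptional ui hq tj oT nzT)).
- apply: (two_of_three_iso (T := orth F) _ _ isoT' oT); first exact: two_of_three_orth_cov.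
  by case: (orth_zero F (@zero_mod_zero k Q)).
move=> R hR R0 RF; rewrite (mono_two_of_three ui hq tj hR R0 RF).
by split; apply: two_of_three_iso.
Qed.

Lemma mutation_exists : exists E' : fgmod,
  (is_zero P /\ exists h (u : {linear {ffun 'I_h -> F} -> E})
     (j : {linear E' -> {ffun 'I_h -> F}}), universal_hom u /\ is_kernel j u)
  \/ (~ is_zero P /\ isomorphic E' P).
Proof.
have [z|nz] := pselect (is_zero P); last first.
  by exists P; right; split=> //; exists (lin_id P), id.
have [h [u uu]] := universal_exists excF E; have [K [i hi]] := kernel_exists u.
have us := (zero_reflection uu).1 z.
(* Hom-finiteness of [F] against [kQ] makes powers of [F] finite-dimensional over [k], hence also
   the submodule [K]. *)
have fgK : finitely_generated K.
  have : bounded (regular_mod k Q) (power F h).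
    apply: two_of_three_power; first exact: two_of_three_bounded_cov.
      by apply: orth_bounded; case: (orth_zero (regular_mod k Q) (@zero_mod_zero k Q)).
    by case: (exc_bounded excF (regular_mod k Q)).
  move=> [n [hn _]]; apply: (@fg_findim _ _ n).
  have iu : short_exact i u by [].
  exact: (cov_hom_ker iu hn).
exists (FGMod fgK); left; split=> //.
by exists h, u, i.
Qed.

End Mutation.

End Reflection.

(** * Adjunctions and the theorem *)

Local Open Scope cat_scope.

Section UniversalArrows.

Definition universal_arrow (C D : category) (R : functor D C) (x : C) (y : D)
    (eta : Defs.hom x (R y)) : Prop :=
  forall (y' : D) (f : Defs.hom x (R y')), exists g : Defs.hom y y',
    cmp (fmap R g) eta = f /\ forall g', cmp (fmap R g') eta = f -> g' = g.

(** Choice picks a universal arrow at every object; uniqueness of factorizations makes the chosen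
    objects functorial. *)
Lemma left_adjoint_of_universal (C D : category) (R : functor D C) :
  (forall x : C, exists (y : D) (eta : Defs.hom x (R y)), universal_arrow eta) ->
  inhabited (left_adjoint R).
Proof.
move=> h; pose L x : D := sval (cid (h x)).
have [eta hL] : exists eta : forall x, Defs.hom x (R (L x)), forall x, universal_arrow (eta x).
  by exists (fun x => sval (cid (svalP (cid (h x))))) => x; exact: svalP (cid _).
have [lift hlift] : exists lift : forall x (y : D) (f : Defs.hom x (R y)), Defs.hom (L x) y,
    forall x (y : D) (f : Defs.hom x (R y)), cmp (fmap R (lift x y f)) (eta x) = f /\
      forall g', cmp (fmap R g') (eta x) = f -> g' = lift x y f.
  exists (fun x y f => sval (cid (hL x y f))) => x y f.
  by case: cid.
have liftE x y f : cmp (fmap R (lift x y f)) (eta x) = f by case: (hlift x y f).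
have uniq x y (g g' : Defs.hom (L x) y) :
    cmp (fmap R g) (eta x) = cmp (fmap R g') (eta x) -> g = g'.
  move=> e; have [_ u] := hlift x y (cmp (fmap R g') (eta x)).
  by rewrite (u _ e) -(u g' erefl).
pose Lmap x y (f : Defs.hom x y) := lift x (L y) (cmp (eta y) f).
have Lid x : Lmap x x (idm x) = idm (L x).
  by apply: uniq; rewrite liftE fmap_id cmp_idl cmp_idr.
have Lcmp x y z (f : Defs.hom y z) (g : Defs.hom x y) :
    Lmap _ _ (cmp f g) = cmp (Lmap _ _ f) (Lmap _ _ g).
  by apply: uniq; rewrite liftE fmap_cmp -cmpA liftE !cmpA liftE.
pose LF : functor C D := Functor Lid Lcmp.
pose tr (x : C) (y : D) (g : Defs.hom (LF x) y) : Defs.hom x (R y) := cmp (fmap R g) (eta x).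
constructor; apply: (@LeftAdjoint _ _ R LF).
apply: (@Adjunction _ _ LF R tr).
- move=> x y; exists (lift x y) => [g|f]; last exact: liftE.
  by apply: uniq; rewrite liftE.
- by move=> x x' y f g; rewrite /tr fmap_cmp -!cmpA /= liftE.
- by move=> x y y' g f; rewrite /tr fmap_cmp cmpA.
Qed.

Section Unit.
Variables (C D : category) (R : functor D C) (L : left_adjoint R).

Definition adj_unit (x : C) : Defs.hom x (R (L x)) := transpose (ladj_adjunction L) (idm (L x)).

Lemma transposeE x y (g : Defs.hom (L x) y) :
  transpose (ladj_adjunction L) g = cmp (fmap R g) (adj_unit x).
Proof. by rewrite -transpose_natr cmp_idr. Qed.

Lemma adj_unit_natural x y (f : Defs.hom x y) :
  cmp (fmap R (fmap L f)) (adj_unit x) = cmp (adj_unit y) f.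
Proof. by rewrite -transposeE -transpose_natl cmp_idl. Qed.

Lemma adj_unit_universal x : universal_arrow (adj_unit x).
Proof.
move=> y f; have [v vt tv] := transpose_bij (ladj_adjunction L) x y.
exists (v f); split=> [|g']; first by rewrite -transposeE tv.
by rewrite -transposeE => <-; rewrite vt.
Qed.

End Unit.

Section CompositeUnit.
Variables (C D D' : category) (R : functor D C) (R' : functor D' D)
  (L : left_adjoint R) (L' : left_adjoint R').

Definition comp_unit (x : C) : Defs.hom x ((R ∘ R') ((L' ∘ L) x)) :=
  cmp (fmap R (adj_unit L' (L x))) (adj_unit L x).

Lemma comp_unit_natural x y (f : Defs.hom x y) :
  cmp (fmap (R ∘ R') (fmap (L' ∘ L) f)) (comp_unit x) = cmp (comp_unit y) f.
Proof.
by rewrite /comp_unit /= cmpA -fmap_cmp adj_unit_natural fmap_cmp -!cmpA adj_unit_natural.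
Qed.

Lemma comp_unit_universal x : universal_arrow (comp_unit x).
Proof.
move=> y f; have [g [gE gu]] := adj_unit_universal L (f : Defs.hom x (R (R' y))).
have [h [hE hu]] := adj_unit_universal L' g.
exists h; rewrite /comp_unit /=; split=> [|h' hh'].
  by rewrite cmpA -fmap_cmp hE gE.
by apply: hu; apply: gu; rewrite fmap_cmp -cmpA.
Qed.

End CompositeUnit.

(** Both functors are left adjoints of [R] relative to [J]. The parameter [J] serves functors
    defined only on a subcategory of [B]. *)
Lemma universal_nat_iso (B C D : category) (J : functor C B) (R : functor D B)
    (L1 L2 : functor C D) (eta1 : forall x, Defs.hom (J x) (R (L1 x)))
    (eta2 : forall x, Defs.hom (J x) (R (L2 x))) :
  (forall x y (f : Defs.hom x y),
    cmp (fmap R (fmap L1 f)) (eta1 x) = cmp (eta1 y) (fmap J f)) ->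
  (forall x y (f : Defs.hom x y),
    cmp (fmap R (fmap L2 f)) (eta2 x) = cmp (eta2 y) (fmap J f)) ->
  (forall x, universal_arrow (eta1 x)) -> (forall x, universal_arrow (eta2 x)) ->
  nat_iso L1 L2.
Proof.
move=> n1 n2 u1 u2.
have uniq (L : functor C D) (eta : forall x, Defs.hom (J x) (R (L x))) x y (g g' : Defs.hom (L x) y) :
    universal_arrow (eta x) -> cmp (fmap R g) (eta x) = cmp (fmap R g') (eta x) -> g = g'.
  by move=> u e; have [g0 [_ h]] := u y (cmp (fmap R g') (eta x)); rewrite (h _ e) -(h g' erefl).
have [a ha] : exists a : forall x, Defs.hom (L1 x) (L2 x),
    forall x, cmp (fmap R (a x)) (eta1 x) = eta2 x.
  by exists (fun x => sval (cid (u1 x _ (eta2 x)))) => x; exact: (svalP (cid (u1 x _ (eta2 x)))).1.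
have [b hb] : exists b : forall x, Defs.hom (L2 x) (L1 x),
    forall x, cmp (fmap R (b x)) (eta2 x) = eta1 x.
  by exists (fun x => sval (cid (u2 x _ (eta1 x)))) => x; exact: (svalP (cid (u2 x _ (eta1 x)))).1.
exists a, b; split=> [x y f|x y f|x|x].
- by apply: (uniq _ eta1) => //; rewrite !fmap_cmp -!cmpA n1 ha n2 !cmpA ha.
- by apply: (uniq _ eta2) => //; rewrite !fmap_cmp -!cmpA n2 hb n1 !cmpA hb.
- by apply: (uniq _ eta2) => //; rewrite fmap_cmp fmap_id -cmpA hb ha cmp_idl.
- by apply: (uniq _ eta1) => //; rewrite fmap_cmp fmap_id -cmpA ha hb cmp_idl.
Qed.

Definition id_functor (C : category) : functor C C :=
  @Functor C C id (fun x y f => f) (fun x => erefl) (fun x y z f g => erefl).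

End UniversalArrows.

(** * Left adjoints of the inclusions of right orthogonals *)

Section PerpAdjoints.
Variables (k : fieldType) (Q : quiver).
Implicit Types E F X : fgmod k Q.

Lemma perp_single E X : perp (single E) X <-> orth E X.
Proof. by split=> [h|h _ ->]; [exact: (h E erefl)|exact: h]. Qed.

Lemma perp_couple E F X : perp (couple E F) X <-> orth E X /\ orth F X.
Proof.
split=> [h|[h1 h2] _ [->|->]] //.
by split; [exact: (h E (or_introl erefl))|exact: (h F (or_intror erefl))].
Qed.

(** Allows an arbitrary left adjoint to be compared with the reflection built from a tower. *)
Lemma unit_reflects E (piE : left_adjoint (iota1 E)) X :
  @reflects k Q E X (sval (piE X)) (adj_unit piE X).
Proof.
split; first exact/perp_single/(svalP (piE X)).
move=> N oN f; have pN : perp (single E) N by apply/perp_single.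
have [g [hg ug]] := @adj_unit_universal _ _ _ piE X (exist _ N pN : perp_cat _) f.
exists g; split=> [x|g' hg'].
  exact: (congr1 (fun h : {linear X -> N} => h x) hg).
by apply: ug; apply: linearP_eq.
Qed.

Lemma reflection_full E F X : exceptional F ->
  exists (T : fgmod k Q) (eta : {linear X -> T}), reflects F eta /\
    (orth E F -> orth E X -> orth E T).
Proof.
move=> excF; have [h [u uu]] := universal_exists excF X.
have [C [T [q [j [hq tj oT cT]]]]] := reflection_exists excF uu.
exists T, (j \o q : {linear X -> T}); split; last exact: cT.
exact: (tower_reflects hq tj oT).
Qed.

Lemma iota1_left_adjoint E : exceptional E -> inhabited (left_adjoint (iota1 E)).
Proof.
move=> excE; apply: left_adjoint_of_universal => X.
have [T [eta [[oT r] _]]] := reflection_full E X excE.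
have pT : perp (single E) T by apply/perp_single.
exists (exist _ T pT : perp_cat _), eta => -[N pN] f.
have oN : orth E N by apply/perp_single.
have [g [hg ug]] := r N oN f.
exists g; split=> [|g' /= hg']; first exact: linearP_eq.
by apply: ug => x; rewrite -hg'.
Qed.

Lemma iota2_left_adjoint E F : exceptional F -> orth E F ->
  inhabited (left_adjoint (iota2 E F)).
Proof.
move=> excF EF; apply: left_adjoint_of_universal => -[X pX].
have oX : orth E X by apply/perp_single.
have [T [eta [[oT r] cT]]] := reflection_full E X excF.
have pT : perp (couple E F) T by apply/perp_couple; split=> //; apply: cT.
exists (exist _ T pT : perp_cat _), eta => -[N pN] f.
have [_ oN] := (perp_couple E F N).1 pN.
have [g [hg ug]] := r N oN f.
exists g; split=> [|g' /= hg']; first exact: linearP_eq.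
by apply: ug => x; rewrite -hg'.
Qed.

(* The reflection of [X] into the orthogonal of [F] already is orthogonal to
   [E], so it agrees with the reflection into the smaller category. *)
Lemma unit2_reflects E F (piEF : left_adjoint (iota2 E F)) (X : perp_cat (single E)) :
  exceptional F -> orth E F ->
  @reflects k Q F (sval X) (sval (piEF X)) (adj_unit piEF X).
Proof.
move=> excF EF; set P : fgmod k Q := sval (piEF X); set eta : {linear sval X -> P} := adj_unit piEF X.
have [oEP oFP] : orth E P /\ orth F P by apply/perp_couple/(svalP (piEF X)).
have oX : orth E (sval X) by apply/perp_single/(svalP X).
have [T [etaT [rT cT]]] := reflection_full E (sval X) excF.
have pT : perp (couple E F) T by apply/perp_couple; split; [exact: cT|exact: rT.1].
have uP := @adj_unit_universal _ _ _ piEF X.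
have [f [hf _]] := uP (exist _ T pT : perp_cat _) etaT.
have [g [hg _]] := rT.2 P oFP eta.
have fE x : (f : {linear P -> T}) (eta x) = etaT x.
  exact: (congr1 (fun h : {linear sval X -> T} => h x) hf).
(* [g \o f] fixes [eta], so it is the identity of [P]; maps out of [P] are then determined by their
   composites with [g], where uniqueness for [T] applies. *)
have gf : (g \o (f : {linear P -> T}) : {linear P -> P}) = lin_id P.
  have [g0 [_ ug]] := uP (piEF X) eta.
  rewrite (ug (g \o (f : {linear P -> T}) : {linear P -> P})) //.
    by apply/esym/ug; apply: linearP_eq.
  by apply: linearP_eq => x /=; rewrite [LHS](congr1 g (fE x)) hg.
split=> // N oN phi; have [h [hh _]] := rT.2 N oN phi.
exists (h \o (f : {linear P -> T})); split=> [x|h' hh'].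
  by rewrite -hh; exact: (congr1 h (fE x)).
have e : (h' \o g : {linear T -> N}) = h.
  by apply: (reflects_unique rT oN) => x; rewrite /= hg hh' hh.
apply: linearP_eq => y.
rewrite -e; apply: congr1.
exact: (esym (congr1 (fun a : {linear P -> P} => a y) gf)).
Qed.

End PerpAdjoints.

Section Mutation.
Variables (k : fieldType) (Q : quiver) (E F : fgmod k Q).

(** Every abelian closed class containing [F] is an admissible [R], so it contains [E] exactly when
    it contains [E']. *)
Lemma closed_mutation (E' X : fgmod k Q) :
  (forall R : fgmod k Q -> Prop,
    two_of_three R -> R (zero_mod k Q) -> R F -> R E <-> R E') ->
  generated (couple F E') X <-> generated (couple E F) X.
Proof.
move=> EE'; have key P : abelian_closed P -> P F -> P E <-> P E'.
  by move=> hP PF; apply: EE' => //; [exact: two_of_three_closed|exact: (closed_zero hP PF)].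
split=> g P hP hC; apply: g => // M [->|->].
- exact: (hC F (or_intror erefl)).
- exact: (key P hP (hC F (or_intror erefl))).1 (hC E (or_introl erefl)).
- exact: (key P hP (hC F (or_introl erefl))).2 (hC E' (or_intror erefl)).
- exact: (hC F (or_introl erefl)).
Qed.

(** For [X] right orthogonal to [F], take as [R] the class of modules left orthogonal to [X]. *)
Lemma perp_mutation (E' X : fgmod k Q) :
  (forall R : fgmod k Q -> Prop,
    two_of_three R -> R (zero_mod k Q) -> R F -> R E <-> R E') ->
  perp (couple E F) X <-> perp (couple F E') X.
Proof.
move=> EE'; rewrite !perp_couple.
have h : orth F X -> orth E X <-> orth E' X.
  move=> oF; apply: (EE' (fun Y => orth Y X)) => //; first exact: two_of_three_orth_con.
  by case: (orth_zero X (@zero_mod_zero k Q)).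
by split=> -[h1 h2]; split=> //; apply/h.
Qed.

End Mutation.

Theorem theorem3p4 (k : fieldType) (Q : quiver) (E F : fgmod k Q)
    (excE : exceptional E) (excF : exceptional F) (EF : orth E F) :
  [/\ inhabited (left_adjoint (iota1 E)),
      inhabited (left_adjoint (iota1 F)) &
      inhabited (left_adjoint (iota2 E F))] /\
  forall (piE : left_adjoint (iota1 E)) (piF : left_adjoint (iota1 F))
         (piEF : left_adjoint (iota2 E F)),
  (exists E', is_varpi piF E E') /\
  forall E', is_varpi piF E E' ->
  [/\ exceptional E',
      forall X, generated (couple F E') X <-> generated (couple E F) X &
      exists same : forall X, perp (couple E F) X <-> perp (couple F E') X,
      inhabited (left_adjoint (iota2 F E')) /\
      forall piFE' : left_adjoint (iota2 F E'),
      [/\ perp_ident same ∘ (piEF ∘ piE) ≅ piFE' ∘ piF,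
          iota1 E ∘ iota2 E F ≅ (iota1 F ∘ iota2 F E') ∘ perp_ident same &
          piF ∘ iota1 E ≅ (iota2 F E' ∘ perp_ident same) ∘ piEF]].
Proof.
split.
  by split; [exact: iota1_left_adjoint|exact: iota1_left_adjoint|exact: iota2_left_adjoint].
move=> piE piF piEF; have r := unit_reflects piF E.
split; first exact: (mutation_exists excF r).
move=> E' vE'; have [excE' FE' EE'] := mutation excE excF EF r vE'.
split=> //; first by move=> X; apply: closed_mutation.
have same X := perp_mutation X EE'.
exists same; split; first exact: iota2_left_adjoint.
move=> piFE'; split.
(* Both composites of projections have universal units for the inclusion of the common orthogonal
   into the module category. *)
- pose eta1 (X : Mod k Q) : Defs.hom X ((iota1 F ∘ iota2 F E') ((perp_ident same ∘ (piEF ∘ piE)) X)) :=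
    comp_unit piE piEF X.
  apply: (universal_nat_iso (J := id_functor (Mod k Q)) (eta1 := eta1)
    (eta2 := comp_unit piF piFE')) => [x y f|x y f|x y f|x].
  + exact: (comp_unit_natural piE piEF f).
  + exact: comp_unit_natural.
  + pose y0 : perp_cat (couple E F) := exist _ (sval y) ((same (sval y)).2 (svalP y)).
    exact: (@comp_unit_universal _ _ _ _ _ piE piEF x y0 f).
  + exact: comp_unit_universal.
(* Both composites of inclusions leave modules and homomorphisms unchanged, so identities are
   natural isomorphisms. *)
- exists (fun X => @idm (Mod k Q) (sval X)), (fun X => @idm (Mod k Q) (sval X)).
  split=> [x y f|x y f|x|x]; last 2 first.
  + exact: (@cmp_idl (Mod k Q) (sval x) (sval x)).
  + exact: (@cmp_idl (Mod k Q) (sval x) (sval x)).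
  + exact: etrans (@cmp_idl (Mod k Q) (sval x) (sval y) f) (esym (@cmp_idr (Mod k Q) (sval x) (sval y) f)).
  + exact: etrans (@cmp_idl (Mod k Q) (sval x) (sval y) f) (esym (@cmp_idr (Mod k Q) (sval x) (sval y) f)).
(* Both sides are left adjoints of [iota1 F] relative to [iota1 E]. *)
- pose eta2 (X : perp_cat (single E)) :
      Defs.hom (iota1 E X) (iota1 F (((iota2 F E' ∘ perp_ident same) ∘ piEF) X)) :=
    adj_unit piEF X.
  pose eta1 (X : perp_cat (single E)) : Defs.hom (iota1 E X) (iota1 F ((piF ∘ iota1 E) X)) :=
    adj_unit piF (sval X).
  apply: (universal_nat_iso (J := iota1 E) (R := iota1 F) (eta1 := eta1) (eta2 := eta2)) => [x y f|x y f|x|x y f].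
  + exact: (adj_unit_natural piF (f : {linear sval x -> sval y})).
  + exact: (adj_unit_natural piEF f).
  + exact: adj_unit_universal.
  (* The unit of [piEF] must be universal against all of the orthogonal of [F], not only against the
     modules also orthogonal to [E]. *)
  have [_ h] := unit2_reflects piEF x excF EF.
  have oy : orth F (sval y) by apply/perp_single/(svalP y).
  have [g [hg ug]] := h (sval y) oy f.
  exists g; split=> [|g' hg']; first exact: linearP_eq.
  apply: ug => z; exact: (congr1 (fun a : {linear sval x -> sval y} => a z) hg').
Qed.
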